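(* There is a dynamic parallel constant-time algorithm on a common CRCW PRAM with $\mathcal{O}(\log n\log\log n)$ processors that maintains membership in the Dyck language $D_1$, i.e., solves the problem Member($D_1$) in which updates only substitute characters (including setting and resetting void characters).
   Context: A common CRCW PRAM consists of synchronized processors (number fixed in advance) sharing memory; concurrent reads are allowed, and concurrent writes to a cell are allowed only if all write the same value. A dynamic parallel constant-time algorithm processes each update and each query in $\mathcal{O}(1)$ parallel time. $D_1$ is the language of well-balanced parentheses expressions over one pair of parentheses $\langle,\rangle$. The erasing function $\mathrm{erase}_{\bot}$ deletes all occurrences of the void character $\bot$ from a string. Problem Member($D_1$): initially $S=\bot^n$. Updates: $\textsc{Set}(i,\sigma)$: if $S[i]=\bot$, set $S[i]$ to $\sigma\in\{\langle,\rangle\}$; $\textsc{Reset}(i)$: set $S[i]$ to $\bot$. Query $\textsc{Member}()$: is $\mathrm{erase}_{\bot}(S)\in D_1$? *)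

(* Defs.v *)
From Stdlib Require Import List Arith.
Import ListNotations.

Inductive paren := Lpar | Rpar.

Inductive D1 : list paren -> Prop :=
| D1_nil : D1 []
| D1_wrap u : D1 u -> D1 (Lpar :: u ++ [Rpar])
| D1_app u v : D1 u -> D1 v -> D1 (u ++ v).

(* [None] is the void character. *)
Definition symbol := option paren.

Definition erase_void (s : list symbol) : list paren :=
  flat_map (fun c => match c with Some q => [q] | None => [] end) s.

(* Positions are numbered from 0. *)
Inductive operation :=
| Set_op (i : nat) (sigma : paren)
| Reset_op (i : nat)
| Member_op.

Definition valid (n : nat) (o : operation) : Prop :=
  match o with
  | Set_op i _ | Reset_op i => i < n
  | Member_op => True
  end.

Definition replace_at (i : nat) (c : symbol) (s : list symbol) : list symbol :=
  firstn i s ++ c :: skipn (S i) s.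

(* [Set_op] has no effect on a position that already holds a parenthesis. *)
Definition apply_op (o : operation) (s : list symbol) : list symbol :=
  match o with
  | Set_op i sigma =>
      match nth_error s i with
      | Some None => replace_at i (Some sigma) s
      | _ => s
      end
  | Reset_op i => replace_at i None s
  | Member_op => s
  end.

Inductive binop := Add | Sub | Mul | Div | And | Or | Xor | Shl | Shr.

Definition eval_binop (o : binop) : nat -> nat -> nat :=
  match o with
  | Add => Nat.add
  | Sub => Nat.sub
  | Mul => Nat.mul
  | Div => Nat.div
  | And => Nat.land
  | Or => Nat.lor
  | Xor => Nat.lxor
  | Shl => Nat.shiftl
  | Shr => Nat.shiftr
  end.

(* [d], [a], [b] are indices of local registers and [l] is a program address;
   a processor halts when its program counter leaves the program. *)
Inductive instr :=
| IConst (d k : nat)              (* r_d := k *)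
| IBin (o : binop) (d a b : nat)  (* r_d := r_a o r_b *)
| ILoad (d a : nat)               (* r_d := M[r_a] *)
| IStore (a b : nat)              (* M[r_a] := r_b *)
| IJumpEq (a b l : nat)           (* if r_a = r_b then goto l *)
| IJumpLt (a b l : nat).          (* if r_a < r_b then goto l *)

Definition program := list instr.

Record cpu := Cpu { pc : nat; regs : nat -> nat }.

Definition memory := nat -> nat.

Record config := Config { cpus : list cpu; mem : memory }.

Definition word (w x : nat) : nat := x mod 2 ^ w.

Definition set_reg (w : nat) (s : cpu) (d v : nat) : cpu :=
  Cpu (S (pc s)) (fun r => if r =? d then word w v else regs s r).

Definition jump_if (s : cpu) (b : bool) (l : nat) : cpu :=
  Cpu (if b then l else S (pc s)) (regs s).

(* One instruction of one processor, with the write (address, value) that it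
   requests, if any. *)
Definition step_cpu (w : nat) (p : program) (m : memory) (s : cpu)
    : cpu * option (nat * nat) :=
  match nth_error p (pc s) with
  | None => (s, None)
  | Some (IConst d k) => (set_reg w s d k, None)
  | Some (IBin o d a b) =>
      (set_reg w s d (eval_binop o (regs s a) (regs s b)), None)
  | Some (ILoad d a) => (set_reg w s d (m (regs s a)), None)
  | Some (IStore a b) =>
      (Cpu (S (pc s)) (regs s), Some (regs s a, regs s b))
  | Some (IJumpEq a b l) => (jump_if s (regs s a =? regs s b) l, None)
  | Some (IJumpLt a b l) => (jump_if s (regs s a <? regs s b) l, None)
  end.

Definition write_requests (l : list (option (nat * nat))) : list (nat * nat) :=
  flat_map (fun x => match x with Some q => [q] | None => [] end) l.

(* The common-CRCW rule. *)
Definition common_writes (ws : list (nat * nat)) : bool :=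
  forallb (fun x =>
    forallb (fun y => implb (fst x =? fst y) (snd x =? snd y)) ws) ws.

Definition commit (ws : list (nat * nat)) (m : memory) : memory :=
  fun a => match find (fun x => fst x =? a) ws with
           | Some x => snd x
           | None => m a
           end.

(* One synchronous step: every processor reads the memory as it was before the
   step, and then all writes take effect.  Conflicting writes are a failure. *)
Definition step (w : nat) (p : program) (c : config) : option config :=
  let rs := map (step_cpu w p (mem c)) (cpus c) in
  let ws := write_requests (map snd rs) in
  if common_writes ws then Some (Config (map fst rs) (commit ws (mem c)))
  else None.

Fixpoint run (w : nat) (p : program) (t : nat) (c : config) : option config :=
  match t with
  | 0 => Some c
  | S t' => match step w p c with
            | Some c' => run w p t' c'
            | None => None
            end
  end.

Definition halted (p : program) (c : config) : Prop :=
  Forall (fun s => length p <= pc s) (cpus c).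

(* The programs do not depend on the length [n] of the string.  On strings of
   length [n] there are [processors n] processors, and words (register and cell
   contents, hence also addresses) have [word_factor * (log2 n + 1)] bits. *)
Record dynamic_algorithm := DynamicAlgorithm {
  word_factor : nat;
  processors : nat -> nat;
  set_program : program;
  reset_program : program;
  member_program : program
}.

Definition word_size (A : dynamic_algorithm) (n : nat) : nat :=
  word_factor A * (Nat.log2 n + 1).

Definition program_of (A : dynamic_algorithm) (o : operation) : program :=
  match o with
  | Set_op _ _ => set_program A
  | Reset_op _ => reset_program A
  | Member_op => member_program A
  end.

Definition position_arg (o : operation) : nat :=
  match o with Set_op i _ | Reset_op i => i | Member_op => 0 end.

Definition symbol_arg (o : operation) : nat :=
  match o with Set_op _ Lpar => 1 | Set_op _ Rpar => 2 | _ => 0 end.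

(* At the start of an operation, registers 0 to 3 hold the processor number,
   [n] and the arguments of the operation; the others hold 0.  Only the shared
   memory survives from one operation to the next. *)
Definition init_cpu (w n : nat) (o : operation) (id : nat) : cpu :=
  Cpu 0 (fun r => word w (nth r [id; n; position_arg o; symbol_arg o] 0)).

Definition init_config (A : dynamic_algorithm) (n : nat) (o : operation)
    (m : memory) : config :=
  Config (map (init_cpu (word_size A n) n o) (seq 0 (processors A n))) m.

Definition executes (A : dynamic_algorithm) (T n : nat) (o : operation)
    (m m' : memory) : Prop :=
  exists c,
    run (word_size A n) (program_of A o) T (init_config A n o m) = Some c /\
    halted (program_of A o) c /\
    mem c = m'.

(* A query leaves its answer, 1 for yes and 0 for no, in cell 0. *)
Definition answers (m : memory) (P : Prop) : Prop :=
  (P /\ m 0 = 1) \/ (~ P /\ m 0 = 0).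

Fixpoint handles (A : dynamic_algorithm) (T n : nat) (m : memory)
    (s : list symbol) (os : list operation) : Prop :=
  match os with
  | [] => True
  | o :: os' =>
      exists m', executes A T n o m m' /\
        (o = Member_op -> answers m' (D1 (erase_void s))) /\
        handles A T n m' (apply_op o s) os'
  end.

(* The shared memory is initially zero; there is no preprocessing. *)
Definition solves_member_D1_in_time (A : dynamic_algorithm) (T : nat) : Prop :=
  forall (n : nat) (os : list operation),
    Forall (valid n) os ->
    handles A T n (fun _ => 0) (repeat None n) os.

Definition solves_member_D1_in_constant_time (A : dynamic_algorithm) : Prop :=
  exists T, solves_member_D1_in_time A T.

Definition bigO (f g : nat -> nat) : Prop :=
  exists C N, forall n, N <= n -> f n <= C * g n.

(* Main.v *)
(* Reducing matching pairs leaves a closing and b opening parentheses; a balanced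
   binary tree over the positions stores this residue (a, b) for every node.  An
   update shifts all later prefix sums by one, so at every node of the path from
   the leaf to the root exactly one component of the residue changes, by one.  A
   single bit per node tells which, and the old residues of the children of the
   node determine this bit either outright or as a copy of the bit of the child
   on the path.  Hence every level has to find the nearest level below it that
   determines its bit.

   With H levels, this is done by O(H log H) processors as follows.  For every
   dyadic block of levels, the last marked level is found with linearly many
   comparisons by first selecting the last nonempty group of about sqrt size and
   then the last element of the group.  Doing the same in the mirror image gives
   the first marked level of a block.  The nearest marked level below j is then
   the last one in the left sibling of the unique dyadic block around j that has
   a nonempty left sibling and no mark up to j. *)
From Stdlib Require Import Arith List Lia Bool.
Require Import Defs.
Import ListNotations.

(** * Residues of parenthesis strings *)

(** The obstacle is the number of processors. Pairwise comparison finds a last mark in constant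
    time, but it costs the square of the number of contestants. With two rounds of about sqrt(L)
    contestants each, a block of L levels costs only about L processors. Each of the K = log2 H
    block sizes covers the levels a bounded number of times, whence H * K; treating separately the
    levels below each j would give about H^2. A processor number therefore encodes a pair (q, k) of
    an index q < 4 * H and a block size 2^k.

    The model shapes the rest. Code without jumps keeps all processors at the same instruction, so a
    program acts on memory as a sequence of simultaneous stores; conditions become 0/1 factors.
    Words are finite, so a static size check, independent of n, reduces evaluation to arithmetic on
    natural numbers. Concurrent writes have to agree: either all write 1, which computes a
    disjunction, or the value is unique. Preprocessing is avoided because zero memory already
    represents the void string, and every update recomputes K and 2^K by parallel search. *)

Definition comb (p q : nat * nat) : nat * nat :=
  (fst p + (fst q - snd p), snd q + (snd p - fst q)).

Definition unit_residue (c : paren) : nat * nat :=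
  match c with Lpar => (0, 1) | Rpar => (1, 0) end.

(* [residue l = (a, b)] when cancelling matching pairs turns [l] into [a]
   closing parentheses followed by [b] opening ones. *)
Definition residue (l : list paren) : nat * nat :=
  fold_right (fun c => comb (unit_residue c)) (0, 0) l.

(** [comb] is the product of the bicyclic monoid; associativity is what lets a tree evaluate it. *)
Lemma comb_assoc p q r : comb p (comb q r) = comb (comb p q) r.
Proof. unfold comb; simpl; f_equal; lia. Qed.

Lemma comb_0_l p : comb (0, 0) p = p.
Proof. destruct p; unfold comb; simpl; f_equal; lia. Qed.

Lemma comb_0_r p : comb p (0, 0) = p.
Proof. destruct p; unfold comb; simpl; f_equal; lia. Qed.

Lemma residue_app u v : residue (u ++ v) = comb (residue u) (residue v).
Proof.
  induction u as [|c u IH]; simpl.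
  - now rewrite comb_0_l.
  - now rewrite IH, comb_assoc.
Qed.

Lemma residue_D1 l : D1 l -> residue l = (0, 0).
Proof.
  induction 1 as [|u _ IH|u v _ IHu _ IHv]; auto.
  - simpl. now rewrite residue_app, IH.
  - now rewrite residue_app, IHu, IHv.
Qed.

(** Induction from the right passes through words that are not yet balanced. These are balanced
    words separated by [b] unmatched opening parentheses, and a closing parenthesis wraps the last
    balanced word. *)
Inductive open_prefix : nat -> list paren -> Prop :=
| open_prefix_O u : D1 u -> open_prefix 0 u
| open_prefix_S b l u :
    open_prefix b l -> D1 u -> open_prefix (S b) (l ++ Lpar :: u).

Lemma open_prefix_app b l u : open_prefix b l -> D1 u -> open_prefix b (l ++ u).
Proof.
  intros [v Hv | b' l' v Hl Hv] Hu.
  - constructor. now apply D1_app.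
  - rewrite <- app_assoc; simpl. constructor; auto. now apply D1_app.
Qed.

Lemma residue_open_prefix l b : residue l = (0, b) -> open_prefix b l.
Proof.
  revert b; induction l as [|c l IH] using rev_ind; intros b.
  - simpl; intros [= <-]. constructor. apply D1_nil.
  - rewrite residue_app. destruct (residue l) as [a b0].
    destruct c; unfold comb; cbn -[Nat.sub];
      intros [Ha Hb]%pair_equal_spec.
    + replace b with (S b0) by lia. apply (open_prefix_S b0 l []).
      * apply IH. f_equal; lia.
      * apply D1_nil.
    + assert (H : open_prefix (S b) l) by (apply IH; f_equal; lia).
      inversion H as [|b1 l' u Hl Hu]; subst.
      rewrite <- app_assoc; simpl.
      apply open_prefix_app; auto. now apply D1_wrap.
Qed.

Lemma D1_residue l : D1 l <-> residue l = (0, 0).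
Proof.
  split.
  - apply residue_D1.
  - intros H. apply residue_open_prefix in H. now inversion H.
Qed.

Lemma erase_void_app s t : erase_void (s ++ t) = erase_void s ++ erase_void t.
Proof. apply flat_map_app. Qed.

(** Positions past the end read as void, so complete binary trees serve strings of every length. *)
Definition at_pos (s : list symbol) (p : nat) : symbol := nth p s None.

Definition node_residue (f : nat -> symbol) (j x : nat) : nat * nat :=
  residue (erase_void (map f (seq (x * 2 ^ j) (2 ^ j)))).

Lemma node_residue_S f j x :
  node_residue f (S j) x =
  comb (node_residue f j (2 * x)) (node_residue f j (2 * x + 1)).
Proof.
  unfold node_residue.
  rewrite <- residue_app, <- erase_void_app, <- map_app.
  do 3 f_equal.
  replace (2 ^ S j) with (2 ^ j + 2 ^ j) by (simpl; lia).
  rewrite seq_app. f_equal; f_equal; lia.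
Qed.

Lemma node_residue_ext f g j x :
  (forall p, p / 2 ^ j = x -> f p = g p) ->
  node_residue f j x = node_residue g j x.
Proof.
  intros H. unfold node_residue. do 2 f_equal.
  apply map_ext_in. intros p Hp%in_seq. apply H.
  symmetry; apply Nat.div_unique with (p - x * 2 ^ j); lia.
Qed.

Lemma node_residue_le f j x :
  fst (node_residue f j x) <= 2 ^ j /\ snd (node_residue f j x) <= 2 ^ j.
Proof.
  revert x; induction j as [|j IH]; intros x.
  - unfold node_residue; simpl. destruct (f _) as [[]|]; simpl; lia.
  - rewrite node_residue_S. unfold comb; simpl.
    specialize (IH (2 * x)) as H1. specialize (IH (2 * x + 1)) as H2.
    simpl in *. lia.
Qed.

Lemma erase_void_at_pos s m :
  erase_void (map (at_pos s) (seq 0 (length s + m))) = erase_void s.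
Proof.
  assert (Hnil : forall k, erase_void (map (at_pos []) (seq k m)) = []).
  { induction m as [|m IH]; intros k; simpl; auto.
    unfold at_pos at 1. destruct k; simpl; apply IH. }
  induction s as [|c s IH]; simpl.
  - apply Hnil.
  - rewrite <- seq_shift, map_map. unfold at_pos at 1; simpl.
    f_equal. exact IH.
Qed.

Lemma node_residue_root s j :
  length s <= 2 ^ j -> node_residue (at_pos s) j 0 = residue (erase_void s).
Proof.
  intros H. unfold node_residue. simpl (0 * 2 ^ j).
  now replace (2 ^ j) with (length s + (2 ^ j - length s)) by lia;
    rewrite erase_void_at_pos.
Qed.

(** * Effect of an update on the residues along its path *)

(* Raising or lowering all prefix sums from some position on by one changes
   exactly one of the two components of a residue by one; [e] tells whether it
   is the first, i.e. whether the minimal prefix sum changes. *)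
Definition moves (up e : bool) (p p' : nat * nat) : Prop :=
  match up, e with
  | true, true => fst p = S (fst p') /\ snd p' = snd p
  | true, false => fst p' = fst p /\ snd p' = S (snd p)
  | false, true => fst p' = S (fst p) /\ snd p' = snd p
  | false, false => fst p' = fst p /\ snd p = S (snd p')
  end.

(** In a residue (a, b), -a is the minimal prefix sum and b the height of the end above it. So this
    asks whether the minimum of the concatenation lies in the right part. A tie counts as right only
    for a downward shift: the part further to the right then falls at least as far, whereas in an
    upward shift the left part keeps the minimum down. *)
Definition overtakes (up : bool) (l r : nat * nat) : bool :=
  snd l + Nat.b2n up <=? fst r.

Lemma moves_comb_l up e p p' r :
  moves up e p p' ->
  moves up (if overtakes up p r then true else e) (comb p r) (comb p' r).
Proof.
  unfold overtakes, comb.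
  destruct (Nat.leb_spec (snd p + Nat.b2n up) (fst r));
    destruct up, e; simpl in *; lia.
Qed.

Lemma moves_comb_r up e l p p' :
  moves up e p p' ->
  moves up (if overtakes up l p then e else false) (comb l p) (comb l p').
Proof.
  unfold overtakes, comb.
  destruct (Nat.leb_spec (snd l + Nat.b2n up) (fst p));
    destruct up, e; simpl in *; lia.
Qed.

Definition overtake_at (f : nat -> symbol) (up : bool) (i j : nat) : bool :=
  overtakes up (node_residue f j (2 * (i / 2 ^ S j)))
               (node_residue f j (2 * (i / 2 ^ S j) + 1)).

Definition side (i j : nat) : bool := Nat.odd (i / 2 ^ j).

Fixpoint carry (f : nat -> symbol) (up e0 : bool) (i j : nat) : bool :=
  match j with
  | 0 => e0
  | S j' =>
      if eqb (overtake_at f up i j') (side i j') then carry f up e0 i j'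
      else negb (side i j')
  end.

Lemma div_pow2_S i j : i / 2 ^ S j = i / 2 ^ j / 2.
Proof. rewrite Nat.pow_succ_r', Nat.mul_comm, Nat.Div0.div_div; auto. Qed.

Lemma side_spec i j : i / 2 ^ j = 2 * (i / 2 ^ S j) + Nat.b2n (side i j).
Proof.
  unfold side. rewrite div_pow2_S, <- Nat.div2_div. apply Nat.div2_odd.
Qed.

(** A residue measures prefix sums from the start of its own node, so the shift of all later
    positions does not reach nodes off the path; at each level only one child moves. *)
Lemma node_residue_moves f f' up e0 i j :
  (forall p, p <> i -> f' p = f p) ->
  moves up e0 (node_residue f 0 i) (node_residue f' 0 i) ->
  moves up (carry f up e0 i j) (node_residue f j (i / 2 ^ j))
    (node_residue f' j (i / 2 ^ j)).
Proof.
  intros Hf H0. induction j as [|j IH].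
  - simpl (2 ^ 0). rewrite Nat.div_1_r. exact H0.
  - rewrite !node_residue_S. simpl carry.
    assert (Hsame : forall x, x <> i / 2 ^ j ->
      node_residue f' j x = node_residue f j x).
    { intros x Hx. apply node_residue_ext. intros p Hp. apply Hf. congruence. }
    pose proof (side_spec i j) as Hs. unfold overtake_at.
    destruct (side i j); simpl Nat.b2n in Hs; rewrite Hs in IH.
    + rewrite (Hsame (2 * (i / 2 ^ S j))) by lia.
      apply moves_comb_r with (l := node_residue f j (2 * (i / 2 ^ S j))) in IH.
      destruct (overtakes _ _ _); exact IH.
    + rewrite Nat.add_0_r in IH.
      rewrite (Hsame (2 * (i / 2 ^ S j) + 1)) by lia.
      apply moves_comb_l with (r := node_residue f j (2 * (i / 2 ^ S j) + 1)) in IH.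
      destruct (overtakes _ _ _); exact IH.
Qed.

Definition fixes (f : nat -> symbol) (up : bool) (i j : nat) : bool :=
  match j with
  | 0 => true
  | S j' => negb (eqb (overtake_at f up i j') (side i j'))
  end.

Definition fixed_value (e0 : bool) (i j : nat) : bool :=
  match j with 0 => e0 | S j' => negb (side i j') end.

Lemma carry_nearest f up e0 i z j :
  z <= j -> fixes f up i z = true ->
  (forall x, z < x <= j -> fixes f up i x = false) ->
  carry f up e0 i j = fixed_value e0 i z.
Proof.
  intros Hz Hfz. induction Hz as [|j Hz IH]; intros Hno.
  - destruct z as [|z]; simpl in *; auto.
    destruct (eqb _ _); [discriminate|auto].
  - specialize (Hno (S j) ltac:(lia)) as Hj. simpl in *.
    destruct (eqb _ _); [|discriminate]. apply IH. intros; apply Hno; lia.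
Qed.

(** * Dyadic blocks of levels *)

(** At the highest level where the blocks of [z] and [j] differ, they still have a common parent.
    They are its two children, and [z < j] makes the block of [j] the right one, hence odd. *)
Lemma separating_level K z j :
  z < j -> z / 2 ^ K = j / 2 ^ K ->
  exists k, k < K /\ j / 2 ^ k = S (z / 2 ^ k) /\ Nat.odd (j / 2 ^ k) = true.
Proof.
  intros Hlt. induction K as [|K IH].
  - rewrite Nat.pow_0_r, !Nat.div_1_r. lia.
  - intros Heq. destruct (Nat.eq_dec (z / 2 ^ K) (j / 2 ^ K)) as [H|H].
    + destruct (IH H) as (k & ? & ?). exists k; auto with arith.
    + exists K. pose proof (side_spec z K) as Hz. pose proof (side_spec j K) as Hj.
      assert (z / 2 ^ K <= j / 2 ^ K) by (apply Nat.Div0.div_le_mono; lia).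
      unfold side in *. rewrite Heq in Hz.
      destruct (Nat.odd (z / 2 ^ K)), (Nat.odd (j / 2 ^ K)); simpl in *;
        repeat split; lia.
Qed.

Lemma div_pow2_mirror k m x :
  x < 2 ^ (k + m) -> (2 ^ (k + m) - 1 - x) / 2 ^ k = 2 ^ m - 1 - x / 2 ^ k.
Proof.
  intros H. symmetry.
  pose proof (Nat.div_mod_eq x (2 ^ k)) as E.
  pose proof (Nat.mod_upper_bound x (2 ^ k) (Nat.pow_nonzero 2 k ltac:(lia))).
  rewrite Nat.pow_add_r in *.
  assert (x / 2 ^ k < 2 ^ m).
  { apply Nat.Div0.div_lt_upper_bound. lia. }
  apply Nat.div_unique with (2 ^ k - 1 - x mod 2 ^ k); [lia|].
  set (q := x / 2 ^ k) in *. nia.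
Qed.

(** * Straight-line parallel programs *)

(* Every processor executes the same jump-free code, so a program is a list of
   synchronous stores; an expression may use the four initial registers. *)
Inductive expr :=
| Num (k : nat)
| Arg (r : nat)
| Op (o : binop) (a b : expr)
| Mem (a : expr).

Fixpoint weval (w : nat) (regs : nat -> nat) (m : memory) (e : expr) : nat :=
  match e with
  | Num k => word w k
  | Arg r => word w (regs r)
  | Op o a b => word w (eval_binop o (weval w regs m a) (weval w regs m b))
  | Mem a => word w (m (weval w regs m a))
  end.

Fixpoint args_only (e : expr) : bool :=
  match e with
  | Num _ => true
  | Arg r => r <? 4
  | Op _ a b => args_only a && args_only b
  | Mem a => args_only a
  end.

(** The registers from [d] on act as a stack. [Or] of a register with itself serves as a copy
    instruction. *)
Fixpoint compile (e : expr) (d : nat) : program :=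
  match e with
  | Num k => [IConst d k]
  | Arg r => [IBin Or d r r]
  | Op o a b => compile a d ++ compile b (S d) ++ [IBin o d d (S d)]
  | Mem a => compile a d ++ [ILoad d d]
  end.

(* (address, value) *)
Definition store := (expr * expr)%type.

Definition compile_store (s : store) : program :=
  compile (fst s) 4 ++ compile (snd s) 5 ++ [IStore 4 5].

Definition compile_all (l : list store) : program := flat_map compile_store l.

Definition requests (w : nat) (regs : nat -> nat -> nat) (ids : list nat)
    (m : memory) (s : store) : list (nat * nat) :=
  map (fun id => (weval w (regs id) m (fst s), weval w (regs id) m (snd s))) ids.

Definition exec_store (w : nat) (regs : nat -> nat -> nat) (ids : list nat)
    (s : store) (m : memory) : option memory :=
  let ws := requests w regs ids m s in
  if common_writes ws then Some (commit ws m) else None.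

Fixpoint exec_all (w : nat) (regs : nat -> nat -> nat) (ids : list nat)
    (l : list store) (m : memory) : option memory :=
  match l with
  | [] => Some m
  | s :: l' =>
      match exec_store w regs ids s m with
      | Some m' => exec_all w regs ids l' m'
      | None => None
      end
  end.

Lemma exec_all_app w regs ids l1 l2 m m1 :
  exec_all w regs ids l1 m = Some m1 ->
  exec_all w regs ids (l1 ++ l2) m = exec_all w regs ids l2 m1.
Proof.
  revert m; induction l1 as [|s l IH]; intros m; simpl.
  - now intros [= ->].
  - destruct (exec_store _ _ _ _ _); [apply IH|discriminate].
Qed.

Lemma run_add w p t1 t2 c c1 :
  run w p t1 c = Some c1 -> run w p (t1 + t2) c = run w p t2 c1.
Proof.
  revert c; induction t1 as [|t IH]; intros c; simpl.
  - now intros [= ->].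
  - destruct (step w p c); [apply IH|discriminate].
Qed.

Definition no_write (w : nat) (p : program) (m : memory) (s : cpu) : Prop :=
  snd (step_cpu w p m s) = None.

Lemma step_no_write w p m (s : nat -> cpu) ids :
  (forall id, no_write w p m (s id)) ->
  step w p (Config (map s ids) m) =
  Some (Config (map (fun id => fst (step_cpu w p m (s id))) ids) m).
Proof.
  intros H. unfold step; cbn [cpus mem].
  assert (E : write_requests (map snd (map (step_cpu w p m) (map s ids))) = []).
  { induction ids as [|id ids IH]; simpl; auto. rewrite H. exact IH. }
  rewrite E. simpl. now rewrite !map_map.
Qed.

Lemma step_write w p m (s : nat -> cpu) ids a b :
  (forall id, nth_error p (pc (s id)) = Some (IStore a b)) ->
  let ws := map (fun id => (regs (s id) a, regs (s id) b)) ids in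
  step w p (Config (map s ids) m) =
  if common_writes ws
  then Some (Config (map (fun id => Cpu (S (pc (s id))) (regs (s id))) ids)
                    (commit ws m))
  else None.
Proof.
  intros H ws. unfold step; cbn [cpus mem].
  assert (E : write_requests (map snd (map (step_cpu w p m) (map s ids))) = ws).
  { unfold ws. clear ws. induction ids as [|id ids IH]; simpl; auto.
    unfold step_cpu at 1. rewrite H. simpl. now rewrite <- IH. }
  rewrite E. rewrite !map_map.
  replace (map (fun x => fst (step_cpu w p m (s x))) ids) with
    (map (fun id => Cpu (S (pc (s id))) (regs (s id))) ids); auto.
  apply map_ext. intros id. unfold step_cpu. now rewrite H.
Qed.

Lemma weval_ext w r r' m e :
  args_only e = true -> (forall k, k < 4 -> r k = r' k) ->
  weval w r m e = weval w r' m e.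
Proof.
  intros He Hr. induction e as [k|k|o a IHa b IHb|a IHa]; simpl in *; auto.
  - apply Nat.ltb_lt in He. now rewrite Hr.
  - apply andb_prop in He as [Ha Hb]. now rewrite IHa, IHb.
Qed.

(** The code sits inside a larger program [p] because instructions are fetched at absolute
    addresses. Preserving the registers below [d] protects both the arguments and the pending left
    operands. *)
Lemma run_compile w e p pre post m ids d (s : nat -> cpu) :
  args_only e = true -> 4 <= d ->
  p = pre ++ compile e d ++ post ->
  (forall id, pc (s id) = length pre) ->
  exists s', run w p (length (compile e d)) (Config (map s ids) m) =
             Some (Config (map s' ids) m) /\
    (forall id, pc (s' id) = length pre + length (compile e d)) /\
    (forall id, regs (s' id) d = weval w (regs (s id)) m e) /\
    (forall id r, r < d -> regs (s' id) r = regs (s id) r).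
Proof.
  revert pre post d s.
  (* Constants, copies, operations and loads all only set register [d] and advance, so one argument
     covers them. *)
  assert (single : forall pre post d (s : nat -> cpu) i v,
    p = pre ++ [i] ++ post ->
    (forall id, pc (s id) = length pre) ->
    (forall s, nth_error p (pc s) = Some i ->
       step_cpu w p m s = (set_reg w s d (v s), None)) ->
    exists s', run w p 1 (Config (map s ids) m) = Some (Config (map s' ids) m) /\
      (forall id, pc (s' id) = length pre + 1) /\
      (forall id, regs (s' id) d = word w (v (s id))) /\
      (forall id r, r < d -> regs (s' id) r = regs (s id) r)).
  { intros pre post d s i v Hp Hpc Hi.
    assert (Hn : forall id, nth_error p (pc (s id)) = Some i).
    { intros id. rewrite Hpc, Hp, nth_error_app2, Nat.sub_diag; auto. }
    exists (fun id => set_reg w (s id) d (v (s id))). repeat split.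
    - unfold run. rewrite step_no_write.
      + do 2 f_equal. apply map_ext. intros id. now rewrite Hi.
      + intros id. unfold no_write. now rewrite Hi.
    - intros id. simpl. rewrite Hpc. lia.
    - intros id. simpl. now rewrite Nat.eqb_refl.
    - intros id r Hr. simpl. destruct (Nat.eqb_spec r d); auto; lia. }
  induction e as [k|k|o a IHa b IHb|a IHa]; intros pre post d s He Hd Hp Hpc;
    simpl in He.
  - apply (single pre post d s (IConst d k) (fun _ => k)); auto.
    intros s0 H. unfold step_cpu. now rewrite H.
  - destruct (single pre post d s (IBin Or d k k) (fun s => regs s k))
      as (s' & H); eauto.
    intros s0 H. unfold step_cpu. rewrite H. simpl. now rewrite Nat.lor_diag.
  - apply andb_prop in He as [Ha Hb].
    simpl in Hp. rewrite <- !app_assoc in Hp.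
    destruct (IHa pre _ d s Ha Hd Hp Hpc) as (s1 & R1 & P1 & V1 & K1).
    destruct (IHb (pre ++ compile a d) ([IBin o d d (S d)] ++ post) (S d) s1)
      as (s2 & R2 & P2 & V2 & K2); auto.
    { now rewrite <- app_assoc. }
    { intros id. now rewrite length_app, P1. }
    destruct (single (pre ++ compile a d ++ compile b (S d)) post d s2
      (IBin o d d (S d)) (fun s => eval_binop o (regs s d) (regs s (S d))))
      as (s3 & R3 & P3 & V3 & K3).
    { now rewrite <- !app_assoc. }
    { intros id. rewrite P2, !length_app. lia. }
    { intros s0 H. unfold step_cpu. now rewrite H. }
    exists s3. repeat split.
    + simpl. rewrite !length_app. rewrite (run_add _ _ _ _ _ _ R1).
      now rewrite (run_add _ _ _ _ _ _ R2).
    + intros id. rewrite P3. simpl. rewrite !length_app. simpl. lia.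
    + intros id. rewrite V3, V2, K2, V1 by lia. simpl. do 2 f_equal.
      apply weval_ext; auto. intros k Hk. apply K1. lia.
    + intros id r Hr. rewrite K3, K2, K1 by lia. reflexivity.
  - simpl in Hp. rewrite <- !app_assoc in Hp.
    destruct (IHa pre _ d s He Hd Hp Hpc) as (s1 & R1 & P1 & V1 & K1).
    destruct (single (pre ++ compile a d) post d s1
      (ILoad d d) (fun s => m (regs s d))) as (s3 & R3 & P3 & V3 & K3).
    { now rewrite <- !app_assoc. }
    { intros id. rewrite P1, !length_app. lia. }
    { intros s0 H. unfold step_cpu. now rewrite H. }
    exists s3. repeat split.
    + simpl. rewrite !length_app. now rewrite (run_add _ _ _ _ _ _ R1).
    + intros id. rewrite P3. simpl. rewrite !length_app. simpl. lia.
    + intros id. now rewrite V3, V1.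
    + intros id r Hr. rewrite K3, K1 by lia. reflexivity.
Qed.

Definition store_args_only (s : store) : bool :=
  args_only (fst s) && args_only (snd s).

(** Address and value are both computed before the single [IStore], and without jumps all processors
    reach it in the same step. All requests thus refer to the same memory [m]. *)
Lemma run_compile_all w rg ids l p pre m m' (s : nat -> cpu) :
  forallb store_args_only l = true ->
  p = pre ++ compile_all l ->
  (forall id, pc (s id) = length pre) ->
  (forall id r, r < 4 -> regs (s id) r = rg id r) ->
  exec_all w rg ids l m = Some m' ->
  exists s', run w p (length (compile_all l)) (Config (map s ids) m) =
             Some (Config (map s' ids) m') /\
    (forall id, pc (s' id) = length p).
Proof.
  revert pre m s; induction l as [|[ea ev] l IH]; intros pre m s Ho Hp Hpc Hr Hx.
  - injection Hx as <-. exists s. split; auto.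
    intros id. now rewrite Hpc, Hp, app_nil_r.
  - simpl in Ho. apply andb_prop in Ho as [Ho Hl].
    apply andb_prop in Ho as [Ha Hv]; simpl in Ha, Hv.
    simpl in Hp. unfold compile_store in Hp; simpl in Hp.
    rewrite <- !app_assoc in Hp.
    destruct (run_compile w ea p pre _ m ids 4 s Ha (le_n 4) Hp Hpc)
      as (s1 & R1 & P1 & V1 & K1).
    destruct (run_compile w ev p (pre ++ compile ea 4)
      ([IStore 4 5] ++ compile_all l) m ids 5 s1) as (s2 & R2 & P2 & V2 & K2);
      auto.
    { now rewrite <- app_assoc. }
    { intros id. now rewrite length_app, P1. }
    assert (E : map (fun id => (regs (s2 id) 4, regs (s2 id) 5)) ids =
                requests w rg ids m (ea, ev)).
    { apply map_ext. intros id. simpl. rewrite V2, K2, V1 by lia. f_equal.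
      - apply weval_ext; auto.
      - apply weval_ext; auto. intros k Hk. rewrite K1 by lia. auto. }
    simpl in Hx. unfold exec_store in Hx.
    destruct (common_writes (requests w rg ids m (ea, ev))) eqn:Hc;
      [|discriminate].
    destruct (IH (pre ++ compile_store (ea, ev))
      (commit (requests w rg ids m (ea, ev)) m)
      (fun id => Cpu (S (pc (s2 id))) (regs (s2 id)))) as (s3 & R3 & P3); auto.
    { unfold compile_store; simpl. now rewrite <- !app_assoc. }
    { intros id. simpl. rewrite P2. unfold compile_store.
      rewrite !length_app. simpl. lia. }
    { intros id r Hr4. simpl. rewrite K2, K1 by lia. auto. }
    exists s3. split; auto.
    simpl. rewrite length_app. unfold compile_store at 1; simpl.
    rewrite !length_app, <- !Nat.add_assoc.
    rewrite (run_add _ _ _ _ _ _ R1), (run_add _ _ _ _ _ _ R2). simpl.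
    rewrite (step_write w p m s2 ids 4 5).
    + rewrite E, Hc. exact R3.
    + intros id. rewrite P2, Hp, <- length_app.
      rewrite app_assoc, app_assoc, nth_error_app2, Nat.sub_diag; auto.
Qed.

Lemma run_halted w p m (s : nat -> cpu) ids t :
  (forall id, pc (s id) = length p) ->
  run w p t (Config (map s ids) m) = Some (Config (map s ids) m).
Proof.
  intros H. induction t as [|t IH]; simpl; auto.
  assert (E : forall id, step_cpu w p m (s id) = (s id, None)).
  { intros id. unfold step_cpu.
    destruct (nth_error_None p (pc (s id))) as [_ ->]; auto. rewrite H; auto. }
  rewrite step_no_write.
  - rewrite (map_ext _ s); auto. intros id. now rewrite E.
  - intros id. unfold no_write. now rewrite E.
Qed.

Definition init_regs (n : nat) (o : operation) (id r : nat) : nat :=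
  nth r [id; n; position_arg o; symbol_arg o] 0.

Lemma weval_word w r m e : weval w (fun k => word w (r k)) m e = weval w r m e.
Proof.
  induction e as [k|k|o a IHa b IHb|a IHa]; simpl; auto.
  - apply Nat.Div0.mod_mod.
Qed.

Lemma exec_all_word w rg ids l m :
  exec_all w (fun id k => word w (rg id k)) ids l m = exec_all w rg ids l m.
Proof.
  revert m; induction l as [|s l IH]; intros m; simpl; auto.
  assert (E : exec_store w (fun id k => word w (rg id k)) ids s m =
              exec_store w rg ids s m).
  { unfold exec_store.
    replace (requests w (fun id k => word w (rg id k)) ids m s) with
      (requests w rg ids m s); auto.
    apply map_ext. intros id. now rewrite !weval_word. }
  rewrite E. destruct (exec_store w rg ids s m); auto.
Qed.

Lemma executes_compile A T n o l m m' :
  program_of A o = compile_all l ->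
  forallb store_args_only l = true ->
  length (compile_all l) <= T ->
  exec_all (word_size A n) (init_regs n o) (seq 0 (processors A n)) l m = Some m' ->
  executes A T n o m m'.
Proof.
  intros Hp Ho HT Hx.
  destruct (run_compile_all (word_size A n)
    (fun id k => word (word_size A n) (init_regs n o id k))
    (seq 0 (processors A n)) l (compile_all l) [] m m'
    (init_cpu (word_size A n) n o)) as (s' & R & P); auto.
  { now rewrite exec_all_word. }
  exists (Config (map s' (seq 0 (processors A n))) m').
  unfold init_config. rewrite Hp. repeat split.
  - replace T with (length (compile_all l) + (T - length (compile_all l))) by lia.
    rewrite (run_add _ _ _ _ _ _ R). now apply run_halted.
  - unfold halted. simpl. apply Forall_forall. intros c.
    rewrite in_map_iff. intros (id & <- & _). now rewrite P.
Qed.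

(** * Absence of overflow *)

Fixpoint neval (regs : nat -> nat) (m : memory) (e : expr) : nat :=
  match e with
  | Num k => k
  | Arg r => regs r
  | Op o a b => eval_binop o (neval regs m a) (neval regs m b)
  | Mem a => m (neval regs m a)
  end.

(* [neval regs m e < 2 ^ (bits e * l)] when registers and cells are below
   [2 ^ (5 * l)]. *)
Fixpoint bits (e : expr) : nat :=
  match e with
  | Num k => S (Nat.log2 k)
  | Arg _ => 5
  | Op Add a b => S (Nat.max (bits a) (bits b))
  | Op Mul a b => bits a + bits b
  | Op _ a b => Nat.max (bits a) (bits b)
  | Mem a => Nat.max 5 (bits a)
  end.

Definition bounded_op (o : binop) : bool :=
  match o with Add | Sub | Mul | Div | Shr => true | _ => false end.

(** Every subexpression is checked, since every intermediate result is truncated. Sizes are counted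
    in multiples of the logarithmic length [l], so one computation settles the matter for all n. *)
Fixpoint fits (F : nat) (e : expr) : bool :=
  (bits e <=? F) &&
  match e with
  | Op o a b => bounded_op o && fits F a && fits F b
  | Mem a => fits F a
  | _ => true
  end.

Lemma word_small w x : x < 2 ^ w -> word w x = x.
Proof. apply Nat.mod_small. Qed.

Lemma weval_neval F ell regs m e :
  1 <= ell -> fits F e = true ->
  (forall r, regs r < 2 ^ (5 * ell)) -> (forall a, m a < 2 ^ (5 * ell)) ->
  weval (F * ell) regs m e = neval regs m e /\
  neval regs m e < 2 ^ (bits e * ell).
Proof.
  intros Hl He Hr Hm.
  assert (mono : forall x a b, x < 2 ^ (a * ell) -> a <= b -> x < 2 ^ (b * ell)).
  { intros x a b H Hab. eapply Nat.lt_le_trans; [exact H|].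
    apply Nat.pow_le_mono_r; nia. }
  assert (Hw : forall x a, x < 2 ^ (a * ell) -> a <= F -> word (F * ell) x = x).
  { intros x a H Ha. apply word_small. eauto. }
  induction e as [k|r|o a IHa b IHb|a IHa];
    cbn [fits] in He; apply andb_prop in He as [HF He];
    apply Nat.leb_le in HF; cbn [weval neval].
  - assert (k < 2 ^ (bits (Num k) * ell)).
    { cbn [bits]. destruct k as [|k]; [apply Nat.neq_0_lt_0, Nat.pow_nonzero; lia|].
      apply mono with (S (Nat.log2 (S k)));
        [|lia].
      eapply Nat.lt_le_trans; [apply Nat.log2_spec; lia|].
      apply Nat.pow_le_mono_r; nia. }
    eauto.
  - split; [|apply Hr]. eapply Hw; [apply Hr|]. exact HF.
  - apply andb_prop in He as [He Hb]. apply andb_prop in He as [Ho Ha].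
    destruct (IHa Ha) as [Ea Ba]. destruct (IHb Hb) as [Eb Bb].
    rewrite Ea, Eb. clear IHa IHb.
    set (x := neval regs m a) in *. set (y := neval regs m b) in *.
    assert (H : eval_binop o x y < 2 ^ (bits (Op o a b) * ell)).
    { pose proof (mono x _ _ Ba (Nat.le_max_l (bits a) (bits b))).
      pose proof (mono y _ _ Bb (Nat.le_max_r (bits a) (bits b))).
      destruct o; try discriminate; cbn [eval_binop bits].
      - assert (x + y < 2 * 2 ^ (Nat.max (bits a) (bits b) * ell)) by lia.
        rewrite <- Nat.pow_succ_r' in H1.
        eapply Nat.lt_le_trans; [exact H1|]. apply Nat.pow_le_mono_r; nia.
      - lia.
      - rewrite Nat.mul_add_distr_r, Nat.pow_add_r. apply Nat.mul_lt_mono; auto.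
      - destruct y as [|y]; [simpl; lia|].
        eapply Nat.le_lt_trans; [apply Nat.Div0.div_le_upper_bound|exact H].
        nia.
      - rewrite Nat.shiftr_div_pow2.
        eapply Nat.le_lt_trans; [apply Nat.Div0.div_le_upper_bound|exact H].
        pose proof (Nat.pow_nonzero 2 y). nia. }
    split; [eapply Hw|]; eauto.
  - destruct (IHa He) as [Ea Ba]. rewrite Ea. cbn [bits] in *.
    assert (m (neval regs m a) < 2 ^ (Nat.max 5 (bits a) * ell)).
    { eapply mono; [apply Hm|]. apply Nat.le_max_l. }
    eauto.
Qed.

(** * Conditional stores *)

Lemma common_writes_spec ws :
  (forall x y, In x ws -> In y ws -> fst x = fst y -> snd x = snd y) ->
  common_writes ws = true.
Proof.
  intros H. apply forallb_forall. intros x Hx. apply forallb_forall. intros y Hy.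
  destruct (Nat.eqb_spec (fst x) (fst y)) as [E|E]; simpl; auto.
  apply Nat.eqb_eq. auto.
Qed.

Lemma commit_hit ws m x :
  (forall x y, In x ws -> In y ws -> fst x = fst y -> snd x = snd y) ->
  In x ws -> commit ws m (fst x) = snd x.
Proof.
  intros H Hx. unfold commit. destruct (find _ ws) as [y|] eqn:E.
  - apply find_some in E as [Hy E]. apply Nat.eqb_eq in E. auto.
  - apply find_none with (x := x) in E; auto. now rewrite Nat.eqb_refl in E.
Qed.

Lemma commit_miss ws m a :
  (forall x, In x ws -> fst x <> a) -> commit ws m a = m a.
Proof.
  intros H. unfold commit. destruct (find _ ws) as [y|] eqn:E; auto.
  apply find_some in E as [Hy E]. apply Nat.eqb_eq in E. now apply H in Hy.
Qed.

(* [t] is the number of an array, with [0 < t < 16]. *)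
Definition arr (m : memory) (t x : nat) : nat := m (16 * x + t).

Definition cell_at (t : nat) (x : expr) : expr := Op Add (Op Mul (Num 16) x) (Num t).
Definition get (t : nat) (x : expr) : expr := Mem (cell_at t x).

(* A store under the condition [c], which is 0 or 1; when it fails, 0 goes to
   cell 0, which belongs to no array. *)
Definition put (c : expr) (t : nat) (x v : expr) : store :=
  (Op Mul c (cell_at t x), Op Mul c v).

(** Subtraction stops at 0, so [1 - (a - b)] is the truth value of a <= b; the comparisons below
    rest on this. *)
Definition e_not (a : expr) : expr := Op Sub (Num 1) a.
Definition e_and (a b : expr) : expr := Op Mul a b.
Definition e_eq (a b : expr) : expr :=
  Op Sub (Num 1) (Op Add (Op Sub a b) (Op Sub b a)).
Definition e_le (a b : expr) : expr := Op Sub (Num 1) (Op Sub a b).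
Definition e_lt (a b : expr) : expr := e_le (Op Add a (Num 1)) b.
Definition e_shr (a b : expr) : expr := Op Shr a b.
Definition e_odd (a : expr) : expr :=
  Op Sub a (Op Mul (Num 2) (Op Div a (Num 2))).

Lemma neval_num r m k : neval r m (Num k) = k.
Proof. reflexivity. Qed.
Lemma neval_add r m a b : neval r m (Op Add a b) = neval r m a + neval r m b.
Proof. reflexivity. Qed.
Lemma neval_sub r m a b : neval r m (Op Sub a b) = neval r m a - neval r m b.
Proof. reflexivity. Qed.
Lemma neval_mul r m a b : neval r m (Op Mul a b) = neval r m a * neval r m b.
Proof. reflexivity. Qed.
Lemma neval_div r m a b : neval r m (Op Div a b) = neval r m a / neval r m b.
Proof. reflexivity. Qed.
Lemma neval_get r m t x : neval r m (get t x) = arr m t (neval r m x).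
Proof. reflexivity. Qed.
Lemma neval_shr r m a b :
  neval r m (e_shr a b) = neval r m a / 2 ^ neval r m b.
Proof. apply Nat.shiftr_div_pow2. Qed.
Lemma neval_eq r m a b :
  neval r m (e_eq a b) = Nat.b2n (neval r m a =? neval r m b).
Proof.
  cbn [neval e_eq eval_binop].
  destruct (Nat.eqb_spec (neval r m a) (neval r m b)); simpl Nat.b2n; lia.
Qed.
Lemma neval_le r m a b :
  neval r m (e_le a b) = Nat.b2n (neval r m a <=? neval r m b).
Proof.
  cbn [neval e_le eval_binop].
  destruct (Nat.leb_spec (neval r m a) (neval r m b)); simpl Nat.b2n; lia.
Qed.
Lemma neval_lt r m a b :
  neval r m (e_lt a b) = Nat.b2n (neval r m a <? neval r m b).
Proof.
  unfold e_lt. rewrite neval_le, neval_add, neval_num, Nat.add_1_r. reflexivity.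
Qed.
Lemma neval_odd r m a : neval r m (e_odd a) = Nat.b2n (Nat.odd (neval r m a)).
Proof.
  cbn [neval e_odd eval_binop]. rewrite <- Nat.div2_div.
  pose proof (Nat.div2_odd (neval r m a)). lia.
Qed.
Lemma neval_not r m a b :
  neval r m a = Nat.b2n b -> neval r m (e_not a) = Nat.b2n (negb b).
Proof. intros H. cbn [neval e_not eval_binop]. rewrite H. now destruct b. Qed.
(** A false first factor annihilates the product. The second may then read meaningless cells, and
    its value is asked for only under the guard. *)
Lemma neval_and r m a b x y :
  neval r m a = Nat.b2n x -> (x = true -> neval r m b = Nat.b2n y) ->
  neval r m (e_and a b) = Nat.b2n (x && y).
Proof.
  intros H1 H2. cbn [neval e_and eval_binop]. rewrite H1.
  destruct x; simpl; auto. rewrite H2 by auto. lia.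
Qed.

Opaque e_not e_and e_eq e_le e_lt e_shr e_odd get.

Section Processors.
Context (F ell P : nat) (rg : nat -> nat -> nat).
Context (Hell : 1 <= ell)
  (Hrg : forall id r, id < P -> rg id r < 2 ^ (5 * ell)).

Definition small (m : memory) : Prop := forall a, m a < 2 ^ (5 * ell).

Definition execs (l : list store) (m m' : memory) : Prop :=
  exec_all (F * ell) rg (seq 0 P) l m = Some m'.

Definition fits_store (s : store) : bool := fits F (fst s) && fits F (snd s).

Lemma execs_app l1 l2 m m1 m2 :
  execs l1 m m1 -> execs l2 m1 m2 -> execs (l1 ++ l2) m m2.
Proof.
  intros H1 H2. unfold execs in *. now rewrite (exec_all_app _ _ _ _ _ _ _ H1).
Qed.

Lemma exec_put (c : expr) (t : nat) (x v : expr) (m : memory)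
    (cb : nat -> bool) (xs vs : nat -> nat) :
  0 < t -> fits_store (put c t x v) = true -> small m ->
  (forall id, id < P -> neval (rg id) m c = Nat.b2n (cb id)) ->
  (forall id, id < P -> cb id = true ->
     neval (rg id) m x = xs id /\ neval (rg id) m v = vs id /\
     vs id < 2 ^ (5 * ell)) ->
  (forall id id', id < P -> id' < P -> cb id = true -> cb id' = true ->
     xs id = xs id' -> vs id = vs id') ->
  exists m', execs [put c t x v] m m' /\ small m' /\
    (forall id, id < P -> cb id = true -> arr m' t (xs id) = vs id) /\
    (forall a, a <> 0 ->
       (forall id, id < P -> cb id = true -> a <> 16 * xs id + t) -> m' a = m a).
Proof.
  intros Ht Hf Hm Hc Hv Hcom.
  apply andb_prop in Hf as [Hf1 Hf2]. cbn [put fst snd] in Hf1, Hf2.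
  set (ws := requests (F * ell) rg (seq 0 P) m (put c t x v)).
  assert (Hws : forall y, In y ws <-> exists id, id < P /\
    y = if cb id then (16 * xs id + t, vs id) else (0, 0)).
  { intros y. unfold ws, requests. rewrite in_map_iff.
    assert (E : forall id, id < P ->
      (weval (F * ell) (rg id) m (Op Mul c (cell_at t x)),
       weval (F * ell) (rg id) m (Op Mul c v)) =
      if cb id then (16 * xs id + t, vs id) else (0, 0)).
    { intros id Hid.
      destruct (weval_neval F ell (rg id) m _ Hell Hf1) as [-> _]; auto.
      destruct (weval_neval F ell (rg id) m _ Hell Hf2) as [-> _]; auto.
      cbn [neval eval_binop cell_at]. rewrite Hc by auto.
      destruct (cb id) eqn:Hb; simpl Nat.b2n; [|f_equal; lia].
      destruct (Hv id Hid Hb) as (-> & -> & _). f_equal; lia. }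
    split.
    - intros (id & <- & Hid%in_seq). exists id. split; [lia|]. apply E. lia.
    - intros (id & Hid & ->). exists id. split; [apply E; auto|].
      apply in_seq. lia. }
  assert (Hcw : forall x y, In x ws -> In y ws -> fst x = fst y -> snd x = snd y).
  { intros a b (id & Hid & ->)%Hws (id' & Hid' & ->)%Hws.
    (* A diverted store goes to cell 0 and a genuine one to [16 * x + t] with [t > 0], so the two
       kinds never collide. *)
    destruct (cb id) eqn:E1, (cb id') eqn:E2; simpl; intros; try lia.
    apply Hcom; auto; lia. }
  exists (commit ws m). split; [|split; [|split]].
  - unfold execs. simpl. unfold exec_store. fold ws.
    now rewrite common_writes_spec.
  - intros a. unfold commit. destruct (find _ ws) as [y|] eqn:E; [|apply Hm].
    apply find_some in E as [Hy _]. apply Hws in Hy as (id & Hid & ->).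
    destruct (cb id) eqn:Hb; simpl; [now apply Hv|].
    apply Nat.neq_0_lt_0, Nat.pow_nonzero. lia.
  - intros id Hid Hb. unfold arr.
    apply (commit_hit ws m (16 * xs id + t, vs id)); auto.
    apply Hws. exists id. now rewrite Hb.
  - intros a Ha Hmiss. apply commit_miss.
    intros y (id & Hid & ->)%Hws. destruct (cb id) eqn:Hb; simpl; auto.
    intros <-. now apply (Hmiss id).
Qed.

Definition same_except (t : nat) (m m' : memory) : Prop :=
  forall t' x, 0 < t' < 16 -> t' <> t -> arr m' t' x = arr m t' x.

Lemma exec_put_pair (Q K : nat) (c : expr) (t : nat) (x v : expr) (m : memory)
    (cb : nat -> nat -> bool) (xs vs : nat -> nat -> nat) :
  P = Q * K -> 0 < t < 16 -> fits_store (put c t x v) = true -> small m ->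
  (forall q k, q < Q -> k < K ->
     neval (rg (q * K + k)) m c = Nat.b2n (cb q k)) ->
  (forall q k, q < Q -> k < K -> cb q k = true ->
     neval (rg (q * K + k)) m x = xs q k /\
     neval (rg (q * K + k)) m v = vs q k /\ vs q k < 2 ^ (5 * ell)) ->
  (forall q k q' k', q < Q -> k < K -> cb q k = true ->
     q' < Q -> k' < K -> cb q' k' = true ->
     xs q k = xs q' k' -> vs q k = vs q' k') ->
  exists m', execs [put c t x v] m m' /\ small m' /\ same_except t m m' /\
    (forall q k, q < Q -> k < K -> cb q k = true ->
       arr m' t (xs q k) = vs q k) /\
    (forall a, (forall q k, q < Q -> k < K -> cb q k = true -> a <> xs q k) ->
       arr m' t a = arr m t a).
Proof.
  intros HP Ht Hf Hm Hc Hv Hcom.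
  assert (dec : forall id, id < P -> id / K < Q /\ id mod K < K /\
    id = id / K * K + id mod K).
  { intros id Hid. assert (K <> 0) by (intros ->; lia).
    pose proof (Nat.mod_upper_bound id K ltac:(auto)).
    pose proof (Nat.div_mod_eq id K). repeat split; auto; try lia.
    apply Nat.Div0.div_lt_upper_bound. lia. }
  destruct (exec_put c t x v m (fun id => cb (id / K) (id mod K))
    (fun id => xs (id / K) (id mod K)) (fun id => vs (id / K) (id mod K)))
    as (m' & H1 & H2 & H3 & H4); auto; try lia.
  - intros id Hid. destruct (dec id Hid) as (? & ? & E).
    now rewrite <- Hc, <- E by auto.
  - intros id Hid Hb. destruct (dec id Hid) as (? & ? & E).
    specialize (Hv _ _ ltac:(eassumption) ltac:(eassumption) Hb).
    now rewrite <- E in Hv.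
  - intros id id' Hid Hid'.
    destruct (dec id Hid) as (? & ? & _), (dec id' Hid') as (? & ? & _).
    intros. eapply Hcom; eauto.
  - exists m'. split; [|split; [|split; [|split]]]; auto.
    + intros t' y Ht' Hne. unfold arr. apply H4; [lia|]. intros. lia.
    + intros q k Hq Hk Hb.
      assert (Hid : q * K + k < P) by nia.
      specialize (H3 (q * K + k) Hid).
      rewrite Nat.div_add_l, (Nat.div_small k K), Nat.add_0_r in H3 by lia.
      rewrite Nat.add_comm, Nat.Div0.mod_add, Nat.mod_small in H3 by lia.
      auto.
    + intros a Ha. unfold arr. apply H4; [lia|]. intros id Hid Hb.
      destruct (dec id Hid) as (? & ? & _).
      specialize (Ha _ _ ltac:(eassumption) ltac:(eassumption) Hb). lia.
Qed.
End Processors.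

(* One more than the largest [x < n] with [f x], or 0. *)
Fixpoint last_true (f : nat -> bool) (n : nat) : nat :=
  match n with
  | 0 => 0
  | S n' => if f n' then n else last_true f n'
  end.

Lemma last_true_S f n x :
  last_true f n = S x <->
  x < n /\ f x = true /\ forall y, x < y < n -> f y = false.
Proof.
  induction n as [|n IH]; simpl; [split; [discriminate|lia]|].
  destruct (f n) eqn:E.
  - split.
    + intros [= <-]. repeat split; auto. lia.
    + intros (Hx & Hf & Hm). destruct (Nat.eq_dec x n) as [->|]; auto.
      rewrite Hm in E; [discriminate|lia].
  - rewrite IH. split; intros (Hx & Hf & Hm).
    + repeat split; auto. intros y Hy.
      destruct (Nat.eq_dec y n) as [->|]; auto. apply Hm; lia.
    + assert (x <> n) by congruence. repeat split; auto; try lia.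
      intros y Hy. apply Hm. lia.
Qed.

Lemma last_true_0 f n :
  last_true f n = 0 <-> forall x, x < n -> f x = false.
Proof.
  induction n as [|n IH]; simpl; [split; auto; lia|].
  destruct (f n) eqn:E.
  - split; [discriminate|]. intros H. rewrite H in E; [discriminate|lia].
  - rewrite IH. split; intros H x Hx; auto.
    destruct (Nat.eq_dec x n) as [->|]; auto. apply H. lia.
Qed.

(** * Selecting the last flagged element of every block *)

Definition param (p : nat) : expr := get 1 (Num p).
Definition e_log : expr := param 0.
Definition e_levels : expr := param 1.
Definition e_size : expr := param 2.
Definition e_active : expr := param 3.
Definition e_up : expr := param 4.
Definition e_start : expr := param 5.

Definition e_q : expr := Op Div (Arg 0) e_levels.
Definition e_k : expr := Op Sub (Arg 0) (Op Mul e_q e_levels).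
Definition e_pair (x k : expr) : expr := Op Add (Op Mul x e_levels) k.
(** 2^r is obtained by shifting 2^K to the right, because a right shift never exceeds its operand
    and so obeys the size bound [bits]. *)
Definition e_pow (r : expr) : expr := e_shr e_size (Op Sub e_levels r).
Definition e_mod (a r : expr) : expr := Op Sub a (Op Mul (e_shr a r) (e_pow r)).

(* Among the [p] flagged by [flag] in each block [p / 2 ^ r], the last one
   survives a comparison with all others of its block. *)
Definition select_code (r : expr) (tb to : nat) (flag value : expr -> expr)
    : list store :=
  let x := e_shr e_q r in
  let y := Op Add (Op Mul (e_shr x r) (e_pow r)) (e_mod e_q r) in
  [ put (e_and (e_lt x y) (flag y)) tb (e_pair x e_k) (Num 1);
    put (e_and (flag e_q) (e_not (get tb (e_pair e_q e_k)))) to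
      (e_pair x e_k) (value e_q) ].

(* Any bound for [bits] on all expressions of the programs would do. *)
Definition factor : nat := 400.

Lemma pair_inj K q k q' k' :
  k < K -> k' < K -> q * K + k = q' * K + k' -> q = q' /\ k = k'.
Proof. intros. assert (q = q') by nia. subst; lia. Qed.

Lemma block_lt x r N y :
  x < 2 ^ N -> r <= N -> y < 2 ^ r -> x / 2 ^ r * 2 ^ r + y < 2 ^ N.
Proof.
  intros Hx Hr Hy. replace N with (r + (N - r)) in * by lia.
  rewrite Nat.pow_add_r in *.
  assert (x / 2 ^ r < 2 ^ (N - r)) by (apply Nat.Div0.div_lt_upper_bound; lia).
  nia.
Qed.

Lemma block_add u r y : y < 2 ^ r -> (u * 2 ^ r + y) / 2 ^ r = u.
Proof.
  intros Hy. rewrite Nat.div_add_l, Nat.div_small; auto.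
  apply Nat.pow_nonzero. lia.
Qed.

Lemma block_mod u r y : y < 2 ^ r -> (u * 2 ^ r + y) mod 2 ^ r = y.
Proof.
  intros Hy. now rewrite Nat.add_comm, Nat.Div0.mod_add, Nat.mod_small.
Qed.

Lemma block_eq x r : x / 2 ^ r * 2 ^ r + x mod 2 ^ r = x.
Proof. pose proof (Nat.div_mod_eq x (2 ^ r)). lia. Qed.

Lemma mod_pow2_lt x r : x mod 2 ^ r < 2 ^ r.
Proof. apply Nat.mod_upper_bound, Nat.pow_nonzero. lia. Qed.

(** * The nearest marked level *)

Lemma last_true_gt f n x : x < n -> f x = true -> x < last_true f n.
Proof.
  intros Hx Hf. destruct (last_true f n) as [|z] eqn:E.
  - rewrite last_true_0 in E. now rewrite E in Hf.
  - apply last_true_S in E as (_ & _ & Hmax).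
    destruct (Nat.le_gt_cases x z); [lia|]. now rewrite Hmax in Hf by lia.
Qed.

Lemma div_pow2_add x a b : x / 2 ^ (a + b) = x / 2 ^ a / 2 ^ b.
Proof. rewrite Nat.pow_add_r. symmetry. apply Nat.Div0.div_div. Qed.

Lemma block_end q k N : q < 2 ^ N -> k <= N -> (q / 2 ^ k + 1) * 2 ^ k <= 2 ^ N.
Proof.
  intros Hq Hk. pose proof (block_lt q k N (2 ^ k - 1) Hq Hk).
  pose proof (Nat.pow_nonzero 2 k). lia.
Qed.

Lemma div_le_self x k : x / 2 ^ k <= x.
Proof.
  apply Nat.Div0.div_le_upper_bound. pose proof (Nat.pow_nonzero 2 k). nia.
Qed.

Section Nearest.
Context (K : nat) (fx : nat -> bool).
Let H := 2 ^ K.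
Let Q := 4 * H.

(* The levels [0, H) followed by their mirror image, so that the first marked
   level of a block can be found as the last one of the mirrored block. *)
Definition mirrored (q : nat) : bool :=
  (q <? 2 * H) && fx (q - (q - (2 * H - 1 - q))).

(** The shift by one lets 0, the content of a cleared cell, stand for an empty block. *)
Definition last_in (k u : nat) : nat :=
  last_true (fun q => mirrored q && (q / 2 ^ k =? u)) Q.

Definition nonempty (k u : nat) : bool := negb (last_in k u =? 0).

Lemma double_size : 2 * H = 2 ^ (K + 1).
Proof. unfold H. now rewrite Nat.add_1_r. Qed.

Lemma mirrored_lt q : mirrored q = true -> q < 2 * H.
Proof. intros [Hq _]%andb_prop. now apply Nat.ltb_lt. Qed.

Lemma last_in_S k u q :
  last_in k u = S q <->
  mirrored q = true /\ q / 2 ^ k = u /\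
  forall x, q < x -> x / 2 ^ k = u -> mirrored x = false.
Proof.
  unfold last_in. rewrite last_true_S, andb_true_iff, Nat.eqb_eq.
  split.
  - intros (Hq & [Hm Hu] & Hmax). repeat split; auto.
    intros x Hx Hxu. destruct (mirrored x) eqn:E; auto.
    pose proof (mirrored_lt _ E).
    specialize (Hmax x). rewrite E, Hxu, Nat.eqb_refl in Hmax. apply Hmax.
    unfold Q. lia.
  - intros (Hm & Hu & Hmax). pose proof (mirrored_lt _ Hm).
    split; [unfold Q; lia|]. repeat split; auto.
    intros x Hx. destruct (Nat.eqb_spec (x / 2 ^ k) u); [|apply andb_false_r].
    now rewrite Hmax by (auto; lia).
Qed.

Lemma last_in_0 k u :
  last_in k u = 0 <-> forall x, x / 2 ^ k = u -> mirrored x = false.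
Proof.
  unfold last_in. rewrite last_true_0. split; intros E x Hx.
  - destruct (mirrored x) eqn:M; auto. pose proof (mirrored_lt _ M). specialize (E x).
    rewrite M, Hx, Nat.eqb_refl in E. apply E. unfold Q. lia.
  - destruct (Nat.eqb_spec (x / 2 ^ k) u); [|apply andb_false_r].
    now rewrite E.
Qed.

Lemma nonempty_spec k u :
  nonempty k u = true <-> exists q, mirrored q = true /\ q / 2 ^ k = u.
Proof.
  unfold nonempty. destruct (last_in k u) as [|q] eqn:E; simpl.
  - rewrite last_in_0 in E. split; [discriminate|].
    intros (q & Hq & Hu). now rewrite E in Hq.
  - apply last_in_S in E as (? & ? & _). split; eauto.
Qed.

Lemma nonempty_0 q : nonempty 0 q = mirrored q.
Proof.
  destruct (mirrored q) eqn:E.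
  - apply nonempty_spec. exists q. split; auto. apply Nat.div_1_r.
  - destruct (nonempty 0 q) eqn:N; auto.
    apply nonempty_spec in N as (x & Hx & <-). rewrite Nat.pow_0_r, Nat.div_1_r in E.
    congruence.
Qed.

Lemma nonempty_end k u :
  k <= K + 1 -> nonempty k u = true -> (u + 1) * 2 ^ k <= 2 * H.
Proof.
  intros Hk (q & Hq & <-)%nonempty_spec. apply mirrored_lt in Hq.
  rewrite double_size in *. now apply block_end.
Qed.

(** Division by [2 ^ h] is monotone, so the group of the last marked element is the last nonempty
    group. *)
Lemma last_group k h u q :
  h <= k -> last_in k u = S q ->
  last_true (fun v => nonempty h v && (v / 2 ^ (k - h) =? u)) Q = S (q / 2 ^ h).
Proof.
  intros Hh (Hm & Hu & Hmax)%last_in_S.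
  assert (split : forall x, x / 2 ^ k = x / 2 ^ h / 2 ^ (k - h)).
  { intros x. rewrite <- div_pow2_add. do 2 f_equal. lia. }
  apply last_true_S. split; [|split].
  - pose proof (div_le_self q h). apply mirrored_lt in Hm.
    unfold Q. lia.
  - rewrite <- split, Hu, Nat.eqb_refl, andb_true_r. apply nonempty_spec. eauto.
  - intros v [Hv _]. destruct (Nat.eqb_spec (v / 2 ^ (k - h)) u) as [E|];
      [|apply andb_false_r].
    rewrite andb_true_r. destruct (nonempty h v) eqn:N; auto.
    apply nonempty_spec in N as (x & Hx & <-). rewrite <- split in E.
    rewrite Hmax in Hx; [discriminate| |auto].
    destruct (Nat.le_gt_cases x q) as [L|]; auto.
    apply (Nat.Div0.div_le_mono _ _ (2 ^ h)) in L. lia.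
Qed.

(** Contestants of the second round are renumbered densely: [p = u * 2 ^ h + y] stands for element
    [y] of the group [g k u] chosen in block [u]. *)
Definition candidate (g : nat -> nat -> nat) (h k p : nat) : nat :=
  g k (p / 2 ^ h) * 2 ^ h + p mod 2 ^ h.

Lemma last_in_group g k h u :
  h <= k -> k < K ->
  (forall q, last_in k u = S q -> g k u = q / 2 ^ h) ->
  match last_true (fun p =>
    nonempty k (p / 2 ^ h) && nonempty 0 (candidate g h k p) &&
    (p / 2 ^ h =? u)) Q
  with 0 => 0 | S p => candidate g h k p + 1 end = last_in k u.
Proof.
  intros Hh Hk Hg. destruct (last_in k u) as [|q] eqn:E.
  - replace (last_true _ _) with 0; auto. symmetry. apply last_true_0.
    intros p _. destruct (Nat.eqb_spec (p / 2 ^ h) u) as [->|];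
      [|apply andb_false_r].
    unfold nonempty at 1. now rewrite E.
  - specialize (Hg q eq_refl). pose proof E as (Hm & Hu & Hmax)%last_in_S.
    pose proof (mod_pow2_lt q h) as Hmod.
    assert (Hb : (u * 2 ^ h + q mod 2 ^ h) / 2 ^ h = u) by (now apply block_add).
    assert (Hc : candidate g h k (u * 2 ^ h + q mod 2 ^ h) = q).
    { unfold candidate. rewrite Hb, Hg, block_mod by auto. apply block_eq. }
    assert (Hne : nonempty k u = true) by (apply nonempty_spec; eauto).
    replace (last_true _ _) with (S (u * 2 ^ h + q mod 2 ^ h)); [lia|].
    symmetry. apply last_true_S. split; [|split].
    + pose proof (nonempty_end k u ltac:(lia) Hne).
      pose proof (Nat.pow_le_mono_r 2 h k ltac:(lia) Hh).
      assert ((u + 1) * 2 ^ h <= 2 * H) by nia.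
      unfold Q. lia.
    + now rewrite Hb, Hc, Hne, nonempty_0, Hm, Nat.eqb_refl.
    + intros p [Hp _]. destruct (Nat.eqb_spec (p / 2 ^ h) u) as [Hpu|];
        [|apply andb_false_r].
      rewrite Hpu, Hne, nonempty_0. simpl. rewrite andb_true_r.
      pose proof (block_eq p h) as Ep. rewrite Hpu in Ep.
      pose proof (block_eq q h) as Eq.
      apply Hmax; unfold candidate; rewrite Hpu, Hg; [lia|].
      replace k with (h + (k - h)) by lia.
      rewrite div_pow2_add, block_add by apply mod_pow2_lt.
      rewrite <- div_pow2_add. replace (h + (k - h)) with k by lia. exact Hu.
Qed.

(** Because [last_in] is one more than a position, the [<=] says that the last mark in the mirrored
    block comes strictly before the image of [j]. Equivalently, every mark in the block of [j] lies
    strictly above [j]. *)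
Definition sees (k j : nat) : bool :=
  Nat.odd (j / 2 ^ k) &&
  ((0 <? last_in k (j / 2 ^ k - 1)) &&
   (last_in k ((2 * H - 1 - j) / 2 ^ k) <=? 2 * H - 1 - j)).

Definition nearest (z j : nat) : Prop :=
  z < j /\ fx z = true /\ forall x, z < x <= j -> fx x = false.

Lemma nearest_unique z z' j : nearest z j -> nearest z' j -> z = z'.
Proof.
  intros (H1 & H2 & H3) (H1' & H2' & H3').
  destruct (Nat.lt_trichotomy z z') as [L|[|L]]; auto.
  - rewrite H3 in H2'; [discriminate|lia].
  - rewrite H3' in H2; [discriminate|lia].
Qed.

(** The argument [q - (q - r)] of [fx] is the minimum of [q] and its mirror image [r]. *)
Lemma mirrored_low x : x < H -> mirrored x = fx x.
Proof.
  intros Hx. unfold mirrored. destruct (Nat.ltb_spec x (2 * H)); [|lia].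
  simpl. f_equal. lia.
Qed.

Lemma mirrored_high x : x < H -> mirrored (2 * H - 1 - x) = fx x.
Proof.
  intros Hx. unfold mirrored. destruct (Nat.ltb_spec (2 * H - 1 - x) (2 * H)); [|lia].
  simpl. f_equal. lia.
Qed.

Lemma mirror_block k x :
  k <= K -> x < 2 * H -> (2 * H - 1 - x) / 2 ^ k = 2 ^ (K + 1 - k) - 1 - x / 2 ^ k.
Proof.
  intros Hk Hx. replace (2 * H) with (2 ^ (k + (K + 1 - k))) in *.
  - now apply div_pow2_mirror.
  - rewrite double_size. f_equal. lia.
Qed.

Lemma block_index_lt k x : k <= K -> x < 2 * H -> x / 2 ^ k < 2 ^ (K + 1 - k).
Proof.
  intros Hk Hx. apply Nat.Div0.div_lt_upper_bound.
  rewrite <- Nat.pow_add_r. replace (k + (K + 1 - k)) with (K + 1) by lia.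
  now rewrite <- double_size.
Qed.

Lemma lt_of_block x y k : x / 2 ^ k < y / 2 ^ k -> x < y.
Proof.
  intros L. destruct (Nat.le_gt_cases y x) as [G|]; auto.
  apply (Nat.Div0.div_le_mono _ _ (2 ^ k)) in G. lia.
Qed.

(** A mark strictly above the reported level and up to [j] would lie either in the left sibling,
    beyond its last mark, or in the block of [j] itself, where the mirrored test excludes it. *)
Lemma sees_sound k j :
  k < K -> j < H -> sees k j = true ->
  nearest (last_in k (j / 2 ^ k - 1) - 1) j.
Proof.
  intros Hk Hj [Hodd [Hpos Hle]%andb_prop]%andb_prop.
  apply Nat.ltb_lt in Hpos. apply Nat.leb_le in Hle.
  assert (j / 2 ^ k <> 0) by (intros E; rewrite E in Hodd; discriminate).
  destruct (last_in k (j / 2 ^ k - 1)) as [|z] eqn:L; [lia|].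
  simpl. rewrite Nat.sub_0_r.
  apply last_in_S in L as (Hz & Hzk & Hmax).
  assert (Hzj : z < j) by (apply lt_of_block with k; lia).
  split; [auto|split].
  - rewrite <- mirrored_low; auto. lia.
  - intros x Hx. destruct (fx x) eqn:E; auto. exfalso.
    assert (z / 2 ^ k <= x / 2 ^ k <= j / 2 ^ k).
    { split; apply Nat.Div0.div_le_mono; lia. }
    destruct (Nat.eq_dec (x / 2 ^ k) (j / 2 ^ k)) as [B|B].
    + rewrite mirror_block, <- B, <- mirror_block in Hle by lia.
      assert (mirrored (2 * H - 1 - x) = true) by (rewrite mirrored_high; auto; lia).
      assert (2 * H - 1 - x < last_in k ((2 * H - 1 - x) / 2 ^ k)).
      { apply last_true_gt; [unfold Q; lia|]. now rewrite H2, Nat.eqb_refl. }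
      lia.
    + rewrite <- mirrored_low, Hmax in E; [discriminate|lia|lia|lia].
Qed.

(** Level 0 is marked, so a nearest mark [z] exists. The level separating [z] from [j] works: a mark
    up to [j] in the block of [j] would lie between [z] and [j]. *)
Lemma sees_complete j :
  fx 0 = true -> j < H -> fx j = false -> exists k, k < K /\ sees k j = true.
Proof.
  intros H0 Hj Hfj. destruct (last_true fx j) as [|z] eqn:L.
  - rewrite last_true_0 in L. rewrite L in H0; [discriminate|].
    destruct j; [congruence|lia].
  - apply last_true_S in L as (Hz & Hfz & Hmax).
    destruct (separating_level K z j Hz) as (k & Hk & Hzj & Hodd).
    { rewrite !Nat.div_small; auto. unfold H in *. lia. }
    exists k. split; auto. unfold sees. rewrite Hodd. simpl. apply andb_true_intro.
    split.
    + apply Nat.ltb_lt. apply Nat.le_lt_trans with z; [lia|].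
      apply last_true_gt; [unfold Q; lia|].
      rewrite mirrored_low, Hfz by lia. apply Nat.eqb_eq. lia.
    + apply Nat.leb_le. destruct (last_in k _) as [|x'] eqn:L; [lia|].
      apply last_in_S in L as (Hm & Hb & _).
      destruct (Nat.le_gt_cases (2 * H - 1 - j) x') as [G|]; [exfalso|lia].
      pose proof Hm as Hx'. apply mirrored_lt in Hx'.
      set (x := 2 * H - 1 - x').
      assert (Ex : x' = 2 * H - 1 - x) by (unfold x; lia).
      rewrite Ex in Hm, Hb. assert (x <= j) by (unfold x; lia).
      rewrite mirrored_high in Hm by lia.
      rewrite !mirror_block in Hb by (unfold x in *; lia).
      pose proof (block_index_lt k x). pose proof (block_index_lt k j).
      assert (Hxj : x / 2 ^ k = j / 2 ^ k) by (unfold x in *; lia).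
      assert (z < x) by (apply lt_of_block with k; lia).
      assert (x <> j) by congruence.
      rewrite Hmax in Hm by lia. discriminate.
Qed.
End Nearest.

(** * Updating the path *)

(* The node of level [j] above the positions [x * 2 ^ j, ..., (x + 1) * 2 ^ j - 1]
   has index [x * 2 ^ K + (2 ^ K - 1 - j)], so that the root has index 0. *)
Definition e_node (x j : expr) : expr :=
  Op Add (Op Mul x e_size) (Op Sub (Op Sub e_size (Num 1)) j).
Definition e_over (j : expr) : expr :=
  let c := Op Sub j (Num 1) in
  let x := Op Mul (Num 2) (e_shr (Arg 2) j) in
  e_le (Op Add (get 3 (e_node x c)) e_up) (get 2 (e_node (Op Add x (Num 1)) c)).
Definition e_side (j : expr) : expr := e_odd (e_shr (Arg 2) (Op Sub j (Num 1))).
Definition e_fixes (j : expr) : expr :=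
  e_not (e_and (e_not (e_eq j (Num 0))) (e_eq (e_over j) (e_side j))).
Definition e_mirror (q : expr) : expr :=
  Op Sub (Op Sub (Op Mul (Num 2) e_size) (Num 1)) q.

Definition e_half : expr := Op Div e_k (Num 2).

(* Arrays: 1 holds the parameters, 2 and 3 the components of the residues, 4 the
   flags of nonempty blocks, 5 and 7 the losers of the two selections, 6 the last
   nonempty group of a block, 8 one more than its last marked level, 9 the nearest
   marked level.  Entry [u * K + k] of 4, 6 and 8 is about block [u]
   of level [k], and that of 5 and 7 about candidate [u] at level [k]. *)
Definition nonempty_code : list store :=
  [ put (e_and (e_lt e_q (Op Mul (Num 2) e_size))
               (e_fixes (Op Sub e_q (Op Sub e_q (e_mirror e_q)))))
      4 (e_pair (e_shr e_q e_k) e_k) (Num 1) ].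

Definition group_code : list store :=
  select_code (Op Sub e_k e_half) 5 6
    (fun p => get 4 (e_pair p e_half)) (fun p => p).

Definition e_candidate (p : expr) : expr :=
  Op Add (Op Mul (get 6 (e_pair (e_shr p e_half) e_k)) (e_pow e_half))
    (e_mod p e_half).

Definition last_code : list store :=
  select_code e_half 7 8
    (fun p => e_and (get 4 (e_pair (e_shr p e_half) e_k))
                    (get 4 (Op Mul (e_candidate p) e_levels)))
    (fun p => Op Add (e_candidate p) (Num 1)).

Definition nearest_code : list store :=
  let l := get 8 (e_pair (Op Sub (e_shr e_q e_k) (Num 1)) e_k) in
  [ put (e_and (e_lt e_q e_size)
           (e_and (e_odd (e_shr e_q e_k))
             (e_and (e_lt (Num 0) l)
                (e_le (get 8 (e_pair (e_shr (e_mirror e_q) e_k) e_k))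
                      (e_mirror e_q)))))
      9 e_q (Op Sub l (Num 1)) ].

(** For [q < H], [t] is the mark of level [q] and selects between [q] and the entry found for it.
    Only arrays 1, 4 and 9 are read, so the bit survives changes of the residues. *)
Definition e_bit : expr :=
  let t := get 4 (Op Mul e_q e_levels) in
  let z := Op Add (Op Mul t e_q) (Op Mul (e_not t) (get 9 e_q)) in
  Op Add (Op Mul (e_eq z (Num 0)) e_start)
    (Op Mul (e_not (e_eq z (Num 0))) (e_not (e_side z))).

Definition move_code : list store :=
  let c := e_and (e_eq e_k (Num 0)) (e_and (e_lt e_q e_size) e_active) in
  let x := e_node (e_shr (Arg 2) e_q) e_q in
  [ put c 2 x (Op Sub (Op Add (get 2 x) (e_and e_bit (e_not e_up)))
                 (e_and e_bit e_up));
    put c 3 x (Op Sub (Op Add (get 3 x) (e_and (e_not e_bit) e_up))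
                 (e_and (e_not e_bit) (e_not e_up))) ].

Definition update_code : list store :=
  nonempty_code ++ group_code ++ last_code ++ nearest_code ++ move_code.

(** [x] is unbounded: nodes beyond the string hold (0, 0), which untouched memory provides. *)
Definition tree (K : nat) (f : nat -> symbol) (m : memory) : Prop :=
  forall j x, j < 2 ^ K ->
    arr m 2 (x * 2 ^ K + (2 ^ K - 1 - j)) = fst (node_residue f j x) /\
    arr m 3 (x * 2 ^ K + (2 ^ K - 1 - j)) = snd (node_residue f j x).

(** * Correctness of the update *)

Section Update.
Context (n : nat) (o : operation) (ell K : nat) (up e0 act : bool).
Context (f : nat -> symbol).
Context (Hell : 1 <= ell) (HK : 1 <= K).
Let H := 2 ^ K.
Let Q := 4 * H.
Let i := position_arg o.
Context (HP : Q * K < 2 ^ (5 * ell)) (Htop : 2 ^ H < 2 ^ (5 * ell))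
  (Hrg : forall id r, id < Q * K -> init_regs n o id r < 2 ^ (5 * ell)).

Notation regs q k := (init_regs n o (q * K + k)).

Definition params (m : memory) : Prop :=
  arr m 1 1 = K /\ arr m 1 2 = 2 ^ K /\ arr m 1 3 = Nat.b2n act /\
  arr m 1 4 = Nat.b2n up /\ arr m 1 5 = Nat.b2n e0.

Lemma params_same t m m' : t <> 1 -> same_except t m m' -> params m -> params m'.
Proof.
  intros Ht Hs (H1 & H2 & H3 & H4 & H5). unfold params.
  rewrite !Hs by lia. auto.
Qed.

Lemma neval_levels m q k : params m -> neval (regs q k) m e_levels = K.
Proof. intros Hp. apply Hp. Qed.

Lemma neval_size m q k : params m -> neval (regs q k) m e_size = 2 ^ K.
Proof. intros Hp. apply Hp. Qed.

Lemma neval_q m q k : params m -> k < K -> neval (regs q k) m e_q = q.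
Proof.
  intros Hp Hk. unfold e_q. rewrite neval_div, neval_levels by auto.
  change (neval _ m (Arg 0)) with (q * K + k).
  rewrite Nat.div_add_l, Nat.div_small; lia.
Qed.

Lemma neval_k m q k : params m -> k < K -> neval (regs q k) m e_k = k.
Proof.
  intros Hp Hk. unfold e_k. rewrite neval_sub, neval_mul, neval_levels, neval_q by auto.
  change (neval _ m (Arg 0)) with (q * K + k). lia.
Qed.

Lemma neval_pair m q k x y : params m ->
  neval (regs q k) m (e_pair x y) =
  neval (regs q k) m x * K + neval (regs q k) m y.
Proof.
  intros Hp. unfold e_pair. now rewrite neval_add, neval_mul, neval_levels.
Qed.

Lemma neval_pow m q k r : params m -> neval (regs q k) m r <= K ->
  neval (regs q k) m (e_pow r) = 2 ^ neval (regs q k) m r.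
Proof.
  intros Hp Hr. unfold e_pow.
  rewrite neval_shr, neval_size, neval_sub, neval_levels by auto.
  set (j := neval _ m r) in *. replace K with (j + (K - j)) at 1 by lia.
  rewrite Nat.pow_add_r, Nat.div_mul; auto. apply Nat.pow_nonzero. lia.
Qed.

Lemma neval_mod m q k a r : params m -> neval (regs q k) m r <= K ->
  neval (regs q k) m (e_mod a r) =
  neval (regs q k) m a mod 2 ^ neval (regs q k) m r.
Proof.
  intros Hp Hr. unfold e_mod.
  rewrite neval_sub, neval_mul, neval_shr, neval_pow by auto.
  set (x := neval _ m a). set (y := neval _ m r).
  pose proof (block_eq x y). lia.
Qed.

Lemma Q_pow : Q = 2 ^ (K + 2).
Proof. unfold Q, H. rewrite Nat.pow_add_r. simpl. lia. Qed.

Notation exec := (execs factor ell (Q * K) (init_regs n o)).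

Definition same_except2 (t1 t2 : nat) (m m' : memory) : Prop :=
  forall t x, 0 < t < 16 -> t <> t1 -> t <> t2 -> arr m' t x = arr m t x.

(** In the first store [q] encodes a comparison: of element [q / 2 ^ r] with the element at offset
    [q mod 2 ^ r] of the same block. The room hypothesis gives every flagged element its [2 ^ r]
    comparisons. In the second store [q] is an element itself. Flags are evaluated in both stores,
    so they must not depend on array [tb]. *)
Lemma select_correct (re : expr) (tb to : nat) (flag value : expr -> expr)
    (m : memory) (r : nat -> nat) (fl : nat -> nat -> bool) (vl : nat -> nat -> nat) :
  1 < tb < 16 -> 1 < to < 16 -> tb <> to ->
  forallb (fits_store factor) (select_code re tb to flag value) = true ->
  small ell m -> params m ->
  (forall x, x < Q * K -> arr m tb x = 0) ->
  (forall x, x < Q * K -> arr m to x = 0) ->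
  (forall k, k < K -> r k <= K) ->
  (forall k p, k < K -> p < Q -> fl k p = true -> p * 2 ^ r k + 2 ^ r k <= Q) ->
  (forall m' q k, params m' -> q < Q -> k < K -> neval (regs q k) m' re = r k) ->
  (forall m' q k x, params m' -> same_except tb m m' -> q < Q -> k < K ->
     neval (regs q k) m' x < Q ->
     neval (regs q k) m' (flag x) = Nat.b2n (fl k (neval (regs q k) m' x))) ->
  (forall m' q k, params m' -> same_except tb m m' -> q < Q -> k < K ->
     fl k q = true ->
     neval (regs q k) m' (value e_q) = vl k q /\ vl k q < 2 ^ (5 * ell)) ->
  exists m', exec (select_code re tb to flag value) m m' /\ small ell m' /\
    same_except2 tb to m m' /\
    forall k u, k < K -> u < Q ->
      arr m' to (u * K + k) =
      match last_true (fun p => fl k p && (p / 2 ^ r k =? u)) Q with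
      | 0 => 0
      | S p => vl k p
      end.
Proof.
  intros Htb Hto Htt Hfits Hm Hpar Hb0 Ho0 Hr Hroom Hre Hfl Hvl.
  assert (Htb' : 0 < tb < 16) by lia. assert (Hto' : 0 < to < 16) by lia.
  cbn [select_code forallb] in Hfits. rewrite !andb_true_r in Hfits.
  apply andb_prop in Hfits as [Hf1 Hf2].
  set (last := fun k u => last_true (fun p => fl k p && (p / 2 ^ r k =? u)) Q).
  set (next := fun q k => q / 2 ^ r k / 2 ^ r k * 2 ^ r k + q mod 2 ^ r k).
  assert (Hnext : forall q k, q < Q -> k < K -> next q k < Q).
  { intros q k Hq Hk. unfold next. rewrite Q_pow in *. apply block_lt.
    - eapply Nat.le_lt_trans; [|exact Hq]. apply Nat.Div0.div_le_upper_bound.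
      pose proof (Nat.pow_nonzero 2 (r k)). nia.
    - specialize (Hr k Hk). lia.
    - apply mod_pow2_lt. }
  assert (Hone : 1 < 2 ^ (5 * ell)).
  { apply Nat.pow_gt_1; lia. }
  destruct (exec_put_pair factor ell (Q * K) (init_regs n o) Hell Hrg Q K _ tb _ _ m
    (fun q k => (q / 2 ^ r k <? next q k) && fl k (next q k))
    (fun q k => q / 2 ^ r k * K + k) (fun _ _ => 1)
    eq_refl Htb' Hf1 Hm) as (m1 & X1 & S1 & E1 & W1 & U1); auto.
  { intros q k Hq Hk.
    assert (Hy : neval (regs q k) m
      (Op Add (Op Mul (e_shr (e_shr e_q re) re) (e_pow re)) (e_mod e_q re)) = next q k).
    { rewrite neval_add, neval_mul, !neval_shr, neval_pow, neval_mod, neval_q, Hre;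
        auto; rewrite Hre; auto. }
    apply neval_and.
    - rewrite neval_lt, neval_shr, Hy, neval_q, Hre by auto. reflexivity.
    - intros _. rewrite Hfl, Hy; auto; try (rewrite Hy; auto).
      intros t x; auto. }
  { intros q k Hq Hk _.
    rewrite neval_pair, neval_shr, neval_q, neval_k, Hre by auto. auto. }
  assert (Hpar1 : params m1) by (apply params_same with tb m; auto; lia).
  assert (Hbad : forall k p, k < K -> p < Q -> fl k p = true ->
    arr m1 tb (p * K + k) = Nat.b2n (negb (last k (p / 2 ^ r k) =? S p))).
  { intros k p Hk Hp Hflp.
    destruct (Nat.eqb_spec (last k (p / 2 ^ r k)) (S p)) as [E|E].
    - apply last_true_S in E as (_ & _ & Hmax). simpl.
      rewrite U1; [apply Hb0; nia|].
      intros q k' Hq Hk' Hc Hx.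
      apply pair_inj in Hx as [Hx <-]; auto.
      apply andb_prop in Hc as [Hlt Hc]. apply Nat.ltb_lt in Hlt.
      rewrite <- Hx in Hlt.
      specialize (Hmax (next q k) (conj Hlt (Hnext q k Hq Hk))).
      simpl in Hmax. rewrite Hc in Hmax. apply Nat.eqb_neq in Hmax.
      apply Hmax. unfold next. rewrite <- Hx. apply block_add, mod_pow2_lt.
    - simpl. destruct (last k (p / 2 ^ r k)) as [|p'] eqn:L.
      + unfold last in L. rewrite last_true_0 in L. specialize (L p Hp).
        simpl in L. now rewrite Hflp, Nat.eqb_refl in L.
      + apply last_true_S in L as (Hp' & Hflp' & Hmax).
        apply andb_prop in Hflp' as [Hflp' Hblk]. apply Nat.eqb_eq in Hblk.
        assert (p < p').
        { destruct (Nat.lt_trichotomy p p') as [|[|Hlt]]; auto; [congruence|].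
          specialize (Hmax p (conj Hlt Hp)). simpl in Hmax.
          now rewrite Hflp, Nat.eqb_refl in Hmax. }
        specialize (Hroom k p Hk Hp Hflp).
        pose proof (mod_pow2_lt p' (r k)) as Hmod.
        (* The index that compares [p] with the last flagged element [p'] of its block, and so marks
           [p] as a loser. *)
        set (q := p * 2 ^ r k + p' mod 2 ^ r k).
        assert (Hq1 : q / 2 ^ r k = p) by (now apply block_add).
        assert (Hq2 : next q k = p').
        { unfold next. rewrite Hq1. unfold q. rewrite block_mod by auto.
          rewrite <- Hblk. apply block_eq. }
        rewrite <- Hq1 at 1. apply W1; auto; [unfold q; lia|].
        rewrite Hq1, Hq2, Hflp'. apply andb_true_intro. split; auto.
        now apply Nat.ltb_lt. }
  destruct (exec_put_pair factor ell (Q * K) (init_regs n o) Hell Hrg Q K _ to _ _ m1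
    (fun q k => fl k q && (last k (q / 2 ^ r k) =? S q))
    (fun q k => q / 2 ^ r k * K + k) (fun q k => vl k q)
    eq_refl Hto' Hf2 S1) as (m2 & X2 & S2 & E2 & W2 & U2).
  { intros q k Hq Hk. apply neval_and.
    - rewrite Hfl; rewrite ?neval_q; auto.
    - intros Hc. rewrite <- (negb_involutive (_ =? _)). apply neval_not.
      rewrite neval_get, neval_pair, neval_q, neval_k by auto. auto. }
  { intros q k Hq Hk [Hc _]%andb_prop.
    rewrite neval_pair, neval_shr, neval_q, neval_k, Hre by auto. auto. }
  (* Each block has one survivor, hence at most one writer. *)
  { intros q k q' k' Hq Hk [_ Hc]%andb_prop Hq' Hk' [_ Hc']%andb_prop Hx.
    apply pair_inj in Hx as [Hx <-]; auto. apply Nat.eqb_eq in Hc, Hc'.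
    rewrite Hx in Hc. congruence. }
  exists m2. split; [|split; [|split]]; auto.
  - change (select_code re tb to flag value) with
      ([hd (Num 0, Num 0) (select_code re tb to flag value)] ++
       tl (select_code re tb to flag value)).
    eapply execs_app; [exact X1|exact X2].
  - intros t x Ht Hn1 Hn2. now rewrite E2, E1.
  - intros k u Hk Hu. destruct (last_true _ Q) as [|p] eqn:L.
    + rewrite U2.
      * rewrite E1 by lia. apply Ho0. nia.
      * intros q k' Hq Hk' [Hc _]%andb_prop Hx.
        apply pair_inj in Hx as [Hx <-]; auto.
        rewrite last_true_0 in L. specialize (L q Hq). simpl in L.
        rewrite Hc, Hx, Nat.eqb_refl in L. discriminate.
    + pose proof L as L'. apply last_true_S in L as (Hp & Hf & _).
      apply andb_prop in Hf as [Hf Hu']. apply Nat.eqb_eq in Hu'.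
      rewrite <- Hu' at 1. apply W2; auto. rewrite Hf, Hu'.
      unfold last. rewrite L'. simpl. apply Nat.eqb_refl.
Qed.
Notation fx := (fixes f up i).
Notation mirrored_fx := (mirrored K fx).
Notation last_in_fx := (last_in K fx).
Notation nonempty_fx := (nonempty K fx).

Lemma K_lt_H : K < H.
Proof. apply Nat.pow_gt_lin_r. lia. Qed.

Lemma neval_up m q k : params m -> neval (regs q k) m e_up = Nat.b2n up.
Proof. intros Hp. apply Hp. Qed.

Lemma neval_start m q k : params m -> neval (regs q k) m e_start = Nat.b2n e0.
Proof. intros Hp. apply Hp. Qed.

Lemma neval_active m q k : params m -> neval (regs q k) m e_active = Nat.b2n act.
Proof. intros Hp. apply Hp. Qed.

Lemma neval_pos m q k : neval (regs q k) m (Arg 2) = i.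
Proof. reflexivity. Qed.

Lemma neval_node m q k x j : params m ->
  neval (regs q k) m (e_node x j) =
  neval (regs q k) m x * H + (H - 1 - neval (regs q k) m j).
Proof.
  intros Hp. unfold e_node.
  rewrite neval_add, neval_mul, !neval_sub, neval_size by auto.
  reflexivity.
Qed.

Lemma eqb_b2n a b : (Nat.b2n a =? Nat.b2n b) = eqb a b.
Proof. now destruct a, b. Qed.

Lemma neval_side m q k j :
  neval (regs q k) m (e_side j) = Nat.b2n (side i (neval (regs q k) m j - 1)).
Proof.
  unfold e_side. rewrite neval_odd, neval_shr, neval_sub. reflexivity.
Qed.

Lemma neval_over m q k j : params m -> tree K f m ->
  0 < neval (regs q k) m j < H ->
  neval (regs q k) m (e_over j) =
  Nat.b2n (overtake_at f up i (neval (regs q k) m j - 1)).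
Proof.
  intros Hp Ht Hj. unfold e_over.
  rewrite neval_le, neval_add, !neval_get, !neval_node, !neval_add, neval_mul,
    neval_shr, neval_sub, !neval_num, neval_up, neval_pos by auto.
  destruct (neval _ m j) as [|j']; [lia|]. replace (S j' - 1) with j' by lia.
  unfold H in *.
  rewrite (proj1 (Ht j' _ ltac:(lia))), (proj2 (Ht j' _ ltac:(lia))).
  reflexivity.
Qed.

Lemma neval_fixes m q k j : params m -> tree K f m ->
  neval (regs q k) m j < H ->
  neval (regs q k) m (e_fixes j) = Nat.b2n (fx (neval (regs q k) m j)).
Proof.
  intros Hp Ht Hj. unfold e_fixes.
  set (j' := neval (regs q k) m j) in *.
  replace (fx j') with
    (negb (negb (j' =? 0) && eqb (overtake_at f up i (j' - 1)) (side i (j' - 1)))).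
  - apply neval_not, neval_and.
    + apply neval_not. rewrite neval_eq. reflexivity.
    + intros Hne. apply negb_true_iff, Nat.eqb_neq in Hne.
      rewrite neval_eq, neval_over, neval_side by (auto; fold j'; lia).
      now rewrite eqb_b2n.
  - destruct j' as [|j1]; auto. simpl. now rewrite Nat.sub_0_r.
Qed.

Lemma neval_mirror m q k x : params m ->
  neval (regs q k) m (e_mirror x) = 2 * H - 1 - neval (regs q k) m x.
Proof.
  intros Hp. unfold e_mirror.
  rewrite !neval_sub, neval_mul, !neval_num, neval_size by auto.
  reflexivity.
Qed.

Lemma neval_half m q k : params m -> k < K -> neval (regs q k) m e_half = k / 2.
Proof.
  intros Hp Hk. unfold e_half.
  now rewrite neval_div, neval_k, neval_num.
Qed.

Lemma Hone : 1 < 2 ^ (5 * ell).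
Proof. apply Nat.pow_gt_1; lia. Qed.

(** Every marked [q] writes 1 for its block at each level [k]: a concurrent write of equal values
    computes a disjunction in one step. The entries for [k = 0] keep the marks themselves. *)
Lemma nonempty_code_correct m :
  small ell m -> params m -> tree K f m ->
  (forall x, x < Q * K -> arr m 4 x = 0) ->
  exists m', exec nonempty_code m m' /\ small ell m' /\ same_except 4 m m' /\
    forall k u, k < K -> u < Q -> arr m' 4 (u * K + k) = Nat.b2n (nonempty_fx k u).
Proof.
  intros Hm Hp Ht H0.
  destruct (exec_put_pair factor ell (Q * K) (init_regs n o) Hell Hrg Q K
    (e_and (e_lt e_q (Op Mul (Num 2) e_size))
       (e_fixes (Op Sub e_q (Op Sub e_q (e_mirror e_q)))))
    4 (e_pair (e_shr e_q e_k) e_k) (Num 1) m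
    (fun q _ => mirrored_fx q)
    (fun q k => q / 2 ^ k * K + k) (fun _ _ => 1)
    eq_refl ltac:(lia) ltac:(vm_compute; reflexivity) Hm)
    as (m' & X & S' & E & W & U); auto.
  - intros q k Hq Hk. unfold mirrored. apply neval_and.
    + rewrite neval_lt, neval_mul, neval_num, neval_q,
        neval_size; auto.
    + intros Hlt. apply Nat.ltb_lt in Hlt. fold H in Hlt.
      rewrite neval_fixes; auto;
        rewrite !neval_sub, neval_mirror, neval_q by auto; auto.
      lia.
  - intros q k Hq Hk _. pose proof Hone.
    rewrite neval_pair, neval_shr, neval_q,
      neval_k; auto.
  - exists m'. repeat split; auto. intros k u Hk Hu.
    destruct (nonempty_fx k u) eqn:N.
    + apply nonempty_spec in N as (q & Hq & <-). simpl. apply W; auto.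
      apply mirrored_lt in Hq. fold H in Hq. unfold Q. lia.
    + rewrite U; [apply H0; nia|].
      intros q k' Hq Hk' Hc Hx. apply pair_inj in Hx as [Hx <-]; auto.
      assert (nonempty_fx k u = true) by (apply nonempty_spec; eauto).
      congruence.
Qed.

Lemma half_bounds k : 2 * (k / 2) <= k <= 2 * (k / 2) + 1.
Proof. pose proof (Nat.div_mod_eq k 2). pose proof (Nat.mod_upper_bound k 2). lia. Qed.

Lemma group_code_correct m :
  small ell m -> params m ->
  (forall k u, k < K -> u < Q -> arr m 4 (u * K + k) = Nat.b2n (nonempty_fx k u)) ->
  (forall x, x < Q * K -> arr m 5 x = 0) ->
  (forall x, x < Q * K -> arr m 6 x = 0) ->
  exists m', exec group_code m m' /\ small ell m' /\ same_except2 5 6 m m' /\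
    forall k u q, k < K -> u < Q -> last_in_fx k u = S q ->
      arr m' 6 (u * K + k) = q / 2 ^ (k / 2).
Proof.
  intros Hm Hp H4 H5 H6.
  destruct (select_correct
    (Op Sub e_k e_half) 5 6 (fun p => get 4 (e_pair p e_half)) (fun p => p) m
    (fun k => k - k / 2) (fun k p => nonempty_fx (k / 2) p) (fun _ p => p)
    ltac:(lia) ltac:(lia) ltac:(lia) ltac:(vm_compute; reflexivity) Hm Hp H5 H6)
    as (m' & X & S' & E & W).
  - intros k Hk. lia.
  (* Each of the groups, of size [2 ^ (k / 2)] among 2 * H levels, needs [2 ^ (k - k / 2)]
     comparisons. For odd [k] this is twice the group size, which is why [Q] is 4 * H and not 2 *
     H. *)
  - intros k p Hk Hq N. pose proof (half_bounds k).
    apply nonempty_end in N; [|lia]. fold H in N.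
    replace (p * 2 ^ (k - k / 2) + 2 ^ (k - k / 2)) with
      ((p + 1) * 2 ^ (k - k / 2)) by lia.
    pose proof (Nat.pow_le_mono_r 2 (k - k / 2) (k / 2 + 1) ltac:(lia) ltac:(lia)) as L.
    rewrite Nat.pow_add_r in L. simpl (2 ^ 1) in L. fold H. nia.
  - intros m1 q k Hp1 Hq Hk.
    now rewrite neval_sub, neval_half, neval_k.
  - intros m1 q k x Hp1 Hs Hq Hk Hx. pose proof (half_bounds k).
    rewrite neval_get, neval_pair, neval_half by auto.
    rewrite Hs by lia. apply H4; auto. lia.
  - intros m1 q k Hp1 _ Hq Hk _. rewrite neval_q by auto.
    split; auto. fold H in Hq. fold Q in Hq. nia.
  - exists m'. repeat split; auto. intros k u q Hk Hu L.
    rewrite W by auto. pose proof (half_bounds k).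
    pose proof (last_group K fx k (k / 2) u q ltac:(lia) L) as G.
    cbv beta. fold H Q in G. now rewrite G.
Qed.

Lemma last_code_correct m :
  small ell m -> params m ->
  (forall k u, k < K -> u < Q -> arr m 4 (u * K + k) = Nat.b2n (nonempty_fx k u)) ->
  (forall k u q, k < K -> u < Q -> last_in_fx k u = S q ->
     arr m 6 (u * K + k) = q / 2 ^ (k / 2)) ->
  (forall x, x < Q * K -> arr m 7 x = 0) ->
  (forall x, x < Q * K -> arr m 8 x = 0) ->
  exists m', exec last_code m m' /\ small ell m' /\ same_except2 7 8 m m' /\
    forall k u, k < K -> u < Q -> arr m' 8 (u * K + k) = last_in_fx k u.
Proof.
  intros Hm Hp H4 H6 H7 H8.
  set (g := fun k u => arr m 6 (u * K + k)).
  set (cand := fun k p => candidate g (k / 2) k p).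
  assert (Hcand : forall m1 q k x, params m1 -> same_except 7 m m1 -> k < K ->
    neval (regs q k) m1 (e_candidate x) = cand k (neval (regs q k) m1 x)).
  { intros m1 q k x Hp1 Hs Hk. pose proof (half_bounds k). unfold e_candidate.
    rewrite neval_add, neval_mul, neval_get, neval_pair, neval_shr,
      neval_k, neval_pow,
      neval_mod, neval_half, Hs
      by (auto; try lia; rewrite neval_half by auto; lia).
    reflexivity. }
  assert (Hne : forall k p, k < K -> p < Q -> nonempty_fx k (p / 2 ^ (k / 2)) = true ->
    cand k p < 2 * H).
  { intros k p Hk Hpq N. pose proof N as (q & Hq & Hu)%nonempty_spec.
    unfold nonempty in N.
    destruct (last_in_fx k (p / 2 ^ (k / 2))) as [|q1] eqn:L; [discriminate|].
    unfold cand, candidate, g.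
    rewrite (H6 k _ q1) by
      (auto; exact (Nat.le_lt_trans _ _ _ (div_le_self _ _) Hpq)).
    apply last_in_S in L as (Hq1 & _). apply mirrored_lt in Hq1.
    pose proof (half_bounds k). unfold H. rewrite double_size in *.
    apply block_lt; [auto|lia|apply mod_pow2_lt]. }
  destruct (select_correct
    e_half 7 8
    (fun p => e_and (get 4 (e_pair (e_shr p e_half) e_k))
                    (get 4 (Op Mul (e_candidate p) e_levels)))
    (fun p => Op Add (e_candidate p) (Num 1)) m
    (fun k => k / 2)
    (fun k p => nonempty_fx k (p / 2 ^ (k / 2)) && nonempty_fx 0 (cand k p))
    (fun k p => cand k p + 1)
    ltac:(lia) ltac:(lia) ltac:(lia) ltac:(vm_compute; reflexivity) Hm Hp H7 H8)
    as (m' & X & S' & E & W).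
  - intros k Hk. pose proof (half_bounds k). lia.
  (* A block has b = [2 ^ (k / 2)] candidates with b comparisons each, and b * b <= [2 ^ k], so the
     comparisons fit into the space of the block. *)
  - intros k p Hk Hq [N _]%andb_prop. pose proof (half_bounds k).
    apply nonempty_end in N; [|lia]. fold H in N. fold H.
    pose proof (block_eq p (k / 2)). pose proof (mod_pow2_lt p (k / 2)).
    pose proof (Nat.pow_le_mono_r 2 (k / 2 + k / 2) k ltac:(lia) ltac:(lia)) as L.
    rewrite Nat.pow_add_r in L.
    set (u := p / 2 ^ (k / 2)) in *. set (b := 2 ^ (k / 2)) in *.
    assert (p + 1 <= (u + 1) * b) by lia.
    assert ((p + 1) * b <= (u + 1) * (b * b)) by nia.
    assert ((u + 1) * (b * b) <= (u + 1) * 2 ^ k) by nia. lia.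
  - intros m1 q k Hp1 Hq Hk. now apply neval_half.
  - intros m1 q k x Hp1 Hs Hq Hk Hx. apply neval_and.
    + rewrite neval_get, neval_pair, neval_shr, neval_half,
        neval_k, Hs by (auto; lia).
      apply H4; auto. eapply Nat.le_lt_trans; [apply div_le_self|auto].
    + intros N. rewrite neval_get, neval_mul, neval_levels, Hcand,
        Hs by (auto; lia).
      rewrite <- (Nat.add_0_r (_ * K)). apply H4; [lia|].
      apply Hne in N; auto. unfold Q. lia.
  - intros m1 q k Hp1 Hs Hq Hk [N _]%andb_prop.
    rewrite neval_add, Hcand, neval_q, neval_num by auto.
    split; auto. apply Hne in N; auto. pose proof K_lt_H. unfold Q in *. nia.
  - exists m'. repeat split; auto. intros k u Hk Hu. rewrite W by auto.
    pose proof (half_bounds k).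
    apply (last_in_group K fx g k (k / 2)); [lia|auto|].
    intros q. now apply H6.
Qed.

Lemma nearest_code_correct m :
  small ell m -> params m ->
  (forall k u, k < K -> u < Q -> arr m 8 (u * K + k) = last_in_fx k u) ->
  exists m', exec nearest_code m m' /\ small ell m' /\ same_except 9 m m' /\
    forall j, j < H -> fx j = false -> nearest fx (arr m' 9 j) j.
Proof.
  intros Hm Hp H8.
  set (l := get 8 (e_pair (Op Sub (e_shr e_q e_k) (Num 1)) e_k)).
  assert (Hl : forall q k, q < H -> k < K ->
    neval (regs q k) m l = last_in_fx k (q / 2 ^ k - 1)).
  { intros q k Hq Hk. unfold l.
    rewrite neval_get, neval_pair, neval_sub, neval_shr, neval_q, neval_k, neval_num
      by auto.
    apply H8; auto. pose proof (div_le_self q k). unfold Q. lia. }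
  destruct (exec_put_pair factor ell (Q * K) (init_regs n o) Hell Hrg Q K
    (e_and (e_lt e_q e_size)
           (e_and (e_odd (e_shr e_q e_k))
             (e_and (e_lt (Num 0) l)
                (e_le (get 8 (e_pair (e_shr (e_mirror e_q) e_k) e_k))
                      (e_mirror e_q)))))
    9 e_q (Op Sub l (Num 1)) m
    (fun q k => (q <? H) && sees K fx k q)
    (fun q _ => q) (fun q k => last_in_fx k (q / 2 ^ k - 1) - 1)
    eq_refl ltac:(lia) ltac:(vm_compute; reflexivity) Hm)
    as (m' & X & S' & E & W & U).
  - intros q k Hq Hk. apply neval_and.
    + rewrite neval_lt, neval_q, neval_size by auto. reflexivity.
    + intros Hlt. apply Nat.ltb_lt in Hlt.
      apply neval_and; [|intros _; apply neval_and; [|intros _]].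
      * rewrite neval_odd, neval_shr, neval_q, neval_k by auto. reflexivity.
      * rewrite neval_lt, neval_num, Hl by auto. reflexivity.
      * rewrite neval_le, neval_get, neval_pair, neval_shr, neval_mirror, neval_q,
          neval_k, H8; auto.
        pose proof (div_le_self (2 * H - 1 - q) k). unfold Q. lia.
  - intros q k Hq Hk [Hlt Hs]%andb_prop. apply Nat.ltb_lt in Hlt.
    rewrite neval_q, neval_sub, Hl, neval_num by auto. repeat split.
    apply sees_sound in Hs as (Hz & _); auto. pose proof K_lt_H. unfold Q in *. nia.
  (* All sizes [k] that see from the same level report the nearest mark, so their writes agree by
     uniqueness. *)
  - intros q k q' k' Hq Hk [Hlt Hs]%andb_prop Hq' Hk' [Hlt' Hs']%andb_prop <-.
    apply Nat.ltb_lt in Hlt. apply sees_sound in Hs, Hs'; auto.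
    eapply nearest_unique; eauto.
  - exists m'. do 3 (split; auto).
    intros j Hj Hf. destruct (sees_complete K fx j) as (k & Hk & Hs); auto.
    rewrite (W j k); auto; [|unfold Q; lia|].
    + apply sees_sound; auto.
    + apply andb_true_intro. split; auto. now apply Nat.ltb_lt.
Qed.

Lemma neval_bit m q : params m -> q < H ->
  (forall u, u < Q -> arr m 4 (u * K) = Nat.b2n (nonempty_fx 0 u)) ->
  (fx q = false -> nearest fx (arr m 9 q) q) ->
  neval (regs q 0) m e_bit = Nat.b2n (carry f up e0 i q).
Proof.
  intros Hp Hq H4 H9.
  set (z := if fx q then q else arr m 9 q).
  assert (Hz : carry f up e0 i q = fixed_value e0 i z).
  { unfold z. destruct (fx q) eqn:E.
    - apply carry_nearest; auto. lia.
    - specialize (H9 eq_refl) as (Hlt & Hfz & Hno).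
      apply carry_nearest; auto. lia. }
  rewrite Hz. unfold e_bit.
  set (t := get 4 (Op Mul e_q e_levels)).
  set (ez := Op Add (Op Mul t e_q) (Op Mul (e_not t) (get 9 e_q))).
  assert (Ht : neval (regs q 0) m t = Nat.b2n (fx q)).
  { unfold t. rewrite neval_get, neval_mul, neval_q, neval_levels, H4, nonempty_0,
      mirrored_low by (auto; unfold Q; lia). reflexivity. }
  assert (Hez : neval (regs q 0) m ez = z).
  { unfold ez. rewrite neval_add, !neval_mul, (neval_not _ _ _ _ Ht), Ht, neval_get,
      neval_q by auto.
    unfold z. destruct (fx q); simpl; lia. }
  assert (Heq : neval (regs q 0) m (e_eq ez (Num 0)) = Nat.b2n (z =? 0)).
  { now rewrite neval_eq, Hez. }
  rewrite neval_add, !neval_mul, (neval_not _ _ _ _ Heq), Heq, neval_start by auto.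
  rewrite (neval_not _ _ _ _ (neval_side m q 0 ez)), Hez.
  destruct z as [|z']; simpl; [lia|]. rewrite Nat.sub_0_r. lia.
Qed.

Context (f' : nat -> symbol) (Hf' : forall p, p <> i -> f' p = f p)
  (Hmove : if act then moves up e0 (node_residue f 0 i) (node_residue f' 0 i)
           else f' i = f i).

Lemma node_residue_new j x :
  act && (x =? i / 2 ^ j) = false -> node_residue f' j x = node_residue f j x.
Proof.
  intros Hx. apply node_residue_ext. intros p Hpx.
  destruct (Nat.eq_dec p i) as [->|]; auto.
  destruct act; auto. subst x. now rewrite Nat.eqb_refl in Hx.
Qed.

Lemma moves_value u e p p' : moves u e p p' ->
  fst p' = fst p + Nat.b2n (e && negb u) - Nat.b2n (e && u) /\
  snd p' = snd p + Nat.b2n (negb e && u) - Nat.b2n (negb e && negb u).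
Proof. destruct u, e; simpl; lia. Qed.

Lemma path_node_inj q q' x x' :
  q < H -> q' < H ->
  x * H + (H - 1 - q) = x' * H + (H - 1 - q') -> q = q' /\ x = x'.
Proof. intros Hq Hq' E. apply pair_inj in E; lia. Qed.

Lemma exec_move_component (t : nat) (sel : nat * nat -> nat) (v : expr) m :
  (forall p, sel p <= Nat.max (fst p) (snd p)) ->
  1 < t < 4 ->
  let c := e_and (e_eq e_k (Num 0)) (e_and (e_lt e_q e_size) e_active) in
  let x := e_node (e_shr (Arg 2) e_q) e_q in
  fits_store factor (put c t x v) = true ->
  small ell m -> params m ->
  (forall j x, j < H -> arr m t (x * H + (H - 1 - j)) = sel (node_residue f j x)) ->
  (forall q, q < H -> act = true ->
     neval (regs q 0) m v = sel (node_residue f' q (i / 2 ^ q))) ->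
  exists m', exec [put c t x v] m m' /\ small ell m' /\ same_except t m m' /\
    forall j x, j < H -> arr m' t (x * H + (H - 1 - j)) = sel (node_residue f' j x).
Proof.
  intros Hsel Ht c x Hfits Hm Hp Hold Hv.
  assert (Ht' : 0 < t < 16) by lia.
  destruct (exec_put_pair factor ell (Q * K) (init_regs n o) Hell Hrg Q K
    c t x v m
    (fun q k => (k =? 0) && ((q <? H) && act))
    (fun q _ => i / 2 ^ q * H + (H - 1 - q))
    (fun q _ => sel (node_residue f' q (i / 2 ^ q)))
    eq_refl Ht' Hfits Hm)
    as (m' & X & S' & E & W & U).
  - intros q k Hq Hk. apply neval_and; [|intros _; apply neval_and; [|intros _]].
    + now rewrite neval_eq, neval_k, neval_num.
    + rewrite neval_lt, neval_q, neval_size by auto. reflexivity.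
    + now apply neval_active.
  - intros q k Hq Hk [Hk0 [Hlt Hact]%andb_prop]%andb_prop.
    apply Nat.eqb_eq in Hk0 as ->. apply Nat.ltb_lt in Hlt.
    unfold x. rewrite neval_node, neval_shr, neval_q, neval_pos, Hv by auto.
    repeat split.
    pose proof (node_residue_le f' q (i / 2 ^ q)).
    specialize (Hsel (node_residue f' q (i / 2 ^ q))).
    pose proof (Nat.pow_le_mono_r 2 q H ltac:(lia) ltac:(lia)). lia.
  - intros q k q' k' Hq Hk [_ [Hlt _]%andb_prop]%andb_prop
      Hq' Hk' [_ [Hlt' _]%andb_prop]%andb_prop Hx.
    apply Nat.ltb_lt in Hlt, Hlt'.
    apply path_node_inj in Hx as [<- _]; auto.
  - exists m'. repeat split; auto. intros j y Hj.
    destruct (act && (y =? i / 2 ^ j)) eqn:C.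
    + apply andb_prop in C as [Hact Hy]. apply Nat.eqb_eq in Hy as ->.
      apply (W j 0); [unfold Q; lia|lia|].
      rewrite Hact. apply Nat.ltb_lt in Hj. now rewrite Hj.
    + rewrite node_residue_new by auto. rewrite U.
      * now apply Hold.
      * intros q k Hq Hk [_ [Hlt Hact]%andb_prop]%andb_prop Hx.
        apply Nat.ltb_lt in Hlt. apply path_node_inj in Hx as [<- ->]; auto.
        now rewrite Hact, Nat.eqb_refl in C.
Qed.

Lemma path_moves q : act = true ->
  moves up (carry f up e0 i q) (node_residue f q (i / 2 ^ q))
    (node_residue f' q (i / 2 ^ q)).
Proof.
  intros Hact. apply node_residue_moves; auto. rewrite Hact in Hmove. exact Hmove.
Qed.

Lemma move_code_correct m :
  small ell m -> params m -> tree K f m ->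
  (forall k u, k < K -> u < Q -> arr m 4 (u * K + k) = Nat.b2n (nonempty_fx k u)) ->
  (forall j, j < H -> fx j = false -> nearest fx (arr m 9 j) j) ->
  exists m', exec move_code m m' /\ small ell m' /\ tree K f' m'.
Proof.
  intros Hm Hp Ht H4 H9.
  (* The second component is updated after the first has changed, so the bit is needed in both
     memories. No array has number 0; [t = 0] covers the unchanged memory. *)
  assert (Hbit : forall t m1 q, t < 4 -> t <> 1 -> same_except t m m1 -> q < H ->
    neval (regs q 0) m1 e_bit = Nat.b2n (carry f up e0 i q)).
  { intros t m1 q Ht4 Ht1 Hs Hq. apply neval_bit; auto.
    - eapply params_same; eauto.
    - intros u Hu. rewrite Hs by lia. rewrite <- (Nat.add_0_r (u * K)). apply H4; lia.
    - rewrite Hs by lia. auto. }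
  destruct (exec_move_component 2 fst
    (Op Sub (Op Add (get 2 (e_node (e_shr (Arg 2) e_q) e_q))
               (e_and e_bit (e_not e_up))) (e_and e_bit e_up)) m)
    as (m1 & X1 & S1 & E1 & T1); auto; try lia.
  { intros j x Hj. now apply Ht. }
  { intros q Hq Hact.
    rewrite (proj1 (moves_value _ _ _ _ (path_moves q Hact))).
    specialize (Hbit 0 m q ltac:(lia) ltac:(lia) ltac:(now intros ?) Hq).
    pose proof (neval_up m q 0 Hp) as Hup.
    rewrite neval_sub, neval_add, neval_get, neval_node, neval_shr, neval_q, neval_pos
      by auto.
    rewrite (neval_and _ _ _ _ _ _ Hbit (fun _ => neval_not _ _ _ _ Hup)),
      (neval_and _ _ _ _ _ _ Hbit (fun _ => Hup)).
    do 2 f_equal. now apply Ht. }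
  assert (Hp1 : params m1) by (apply params_same with 2 m; auto).
  destruct (exec_move_component 3 snd
    (Op Sub (Op Add (get 3 (e_node (e_shr (Arg 2) e_q) e_q))
               (e_and (e_not e_bit) e_up)) (e_and (e_not e_bit) (e_not e_up))) m1)
    as (m2 & X2 & S2 & E2 & T2); auto; try lia.
  { intros j x Hj. rewrite E1 by lia. now apply Ht. }
  { intros q Hq Hact.
    rewrite (proj2 (moves_value _ _ _ _ (path_moves q Hact))).
    specialize (Hbit 2 m1 q ltac:(lia) ltac:(lia) E1 Hq).
    pose proof (neval_up m1 q 0 Hp1) as Hup.
    pose proof (neval_not _ _ _ _ Hbit) as Hnbit.
    rewrite neval_sub, neval_add, neval_get, neval_node, neval_shr, neval_q, neval_pos
      by auto.
    rewrite (neval_and _ _ _ _ _ _ Hnbit (fun _ => neval_not _ _ _ _ Hup)),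
      (neval_and _ _ _ _ _ _ Hnbit (fun _ => Hup)).
    do 2 f_equal. rewrite E1 by lia. now apply Ht. }
  exists m2. split; [|split; auto].
  - exact (execs_app _ _ _ _ [_] [_] _ _ _ X1 X2).
  - intros j x Hj. rewrite E2 by lia. split; [now apply T1|now apply T2].
Qed.

Lemma update_code_correct m :
  small ell m -> params m -> tree K f m ->
  (forall t x, 3 < t < 10 -> x < Q * K -> arr m t x = 0) ->
  exists m', exec update_code m m' /\ small ell m' /\ tree K f' m'.
Proof.
  intros Hm Hp Ht H0.
  destruct (nonempty_code_correct m) as (m1 & X1 & S1 & E1 & W1); auto.
  { intros x. apply H0. lia. }
  assert (Hp1 : params m1) by (apply params_same with 4 m; auto).
  destruct (group_code_correct m1) as (m2 & X2 & S2 & E2 & W2); auto.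
  { intros x Hx. rewrite E1 by lia. apply H0; auto. lia. }
  { intros x Hx. rewrite E1 by lia. apply H0; auto. lia. }
  assert (Hp2 : params m2).
  { unfold params in *. rewrite !E2 by lia. auto. }
  destruct (last_code_correct m2) as (m3 & X3 & S3 & E3 & W3); auto.
  { intros k u Hk Hu. rewrite E2 by lia. auto. }
  { intros x Hx. rewrite E2, E1 by lia. apply H0; auto. lia. }
  { intros x Hx. rewrite E2, E1 by lia. apply H0; auto. lia. }
  assert (Hp3 : params m3).
  { unfold params in *. rewrite !E3 by lia. auto. }
  destruct (nearest_code_correct m3) as (m4 & X4 & S4 & E4 & W4); auto.
  assert (Hp4 : params m4) by (apply params_same with 9 m3; auto).
  destruct (move_code_correct m4) as (m5 & X5 & S5 & T5); auto.
  { intros j x Hj. rewrite !E4, !E3, !E2, !E1 by lia. auto. }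
  { intros k u Hk Hu. rewrite E4, E3, E2 by lia. auto. }
  exists m5. split; auto. unfold update_code.
  eapply execs_app; [exact X1|]. eapply execs_app; [exact X2|].
  eapply execs_app; [exact X3|]. eapply execs_app; [exact X4|exact X5].
Qed.
End Update.

(** * Setting up an operation *)

(** One cell per processor suffices: the entries in use, [u * K + k] with [u < Q] and [k < K], are
    exactly the processor numbers. *)
Definition clear_code : list store :=
  map (fun t => put (Num 1) t (Arg 0) (Num 0)) (seq 4 6).

(* A processor whose number [t] satisfies [x / 2 ^ t = 1] has found [log2 x]. *)
Definition init_code (active up start : expr) : list store :=
  [ put (e_eq (e_shr (Op Add (Op Mul (Num 2) (Arg 1)) (Num 1)) (Arg 0)) (Num 1))
      1 (Num 0) (Arg 0);
    put (e_eq (e_shr e_log (Arg 0)) (Num 1)) 1 (Num 1) (Op Add (Arg 0) (Num 1));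
    put (e_and (e_eq (e_shr (Arg 0) e_levels) (Num 1))
               (e_eq (e_shr (Op Sub (Arg 0) (Num 1)) e_levels) (Num 0)))
      1 (Num 2) (Arg 0);
    put (Num 1) 1 (Num 3) active;
    put (Num 1) 1 (Num 4) up;
    put (Num 1) 1 (Num 5) start ] ++ clear_code.

(** The string is not stored separately: a leaf residue (0, 0), (0, 1) or (1, 0) identifies the
    symbol. *)
Definition e_leaf (t : nat) : expr := get t (e_node (Arg 2) (Num 0)).
Definition e_void : expr := e_eq (Op Add (e_leaf 2) (e_leaf 3)) (Num 0).

Definition set_code : list store :=
  init_code e_void (e_eq (Arg 3) (Num 1)) (e_eq (Arg 3) (Num 2)) ++ update_code.
(** Removing a closing parenthesis raises the later prefix sums and changes the first component;
    removing an opening one lowers them and changes the second. Direction and starting bit thus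
    coincide, whereas for setting they are opposite. *)
Definition reset_code : list store :=
  init_code (e_not e_void) (e_eq (e_leaf 2) (Num 1)) (e_eq (e_leaf 2) (Num 1)) ++
  update_code.
(** The root has entry 0 whatever n is, so a query needs no parameters and is correct even before
    any update has computed them. *)
Definition member_code : list store :=
  [ (Num 0, Op Sub (Num 1) (Op Add (get 2 (Num 0)) (get 3 (Num 0)))) ].

(** With K = [levels n], the root is at level 2^K - 1, which is at least [log2 (2 * n + 1)], so it
    covers n positions. For n > 0 that logarithm is [log2 n + 1], hence positive, as the search for
    its own logarithm requires. *)
Definition levels (n : nat) : nat := Nat.log2 (Nat.log2 (2 * n + 1)) + 1.

Definition D1_algorithm : dynamic_algorithm :=
  DynamicAlgorithm factor (fun n => 4 * 2 ^ levels n * levels n)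
    (compile_all set_code) (compile_all reset_code) (compile_all member_code).

(** * Size of the tree and of the words *)

Lemma div_pow2_eq_1 x t : x / 2 ^ t = 1 <-> 0 < x /\ Nat.log2 x = t.
Proof.
  pose proof (Nat.pow_nonzero 2 t ltac:(lia)).
  pose proof (block_eq x t). pose proof (mod_pow2_lt x t).
  split.
  - intros E. rewrite E in *. split; [lia|].
    apply Nat.log2_unique; [lia|]. rewrite Nat.pow_succ_r'. lia.
  - intros [Hx <-]. pose proof (Nat.log2_spec x Hx) as [L U].
    rewrite Nat.pow_succ_r' in U. set (y := 2 ^ Nat.log2 x) in *.
    symmetry. apply Nat.div_unique with (x - y); lia.
Qed.

Lemma levels_gt n : Nat.log2 (2 * n + 1) < 2 ^ levels n.
Proof.
  unfold levels. set (l := Nat.log2 (2 * n + 1)).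
  destruct l as [|l]; [apply Nat.neq_0_lt_0, Nat.pow_nonzero; lia|].
  rewrite Nat.add_1_r. apply Nat.log2_spec. lia.
Qed.

Lemma levels_le n : 2 ^ levels n <= 2 * (Nat.log2 n + 1).
Proof.
  unfold levels. destruct n as [|n]; [reflexivity|].
  rewrite Nat.log2_succ_double, Nat.add_1_r, Nat.pow_succ_r' by lia.
  apply Nat.mul_le_mono_l. rewrite Nat.add_1_r. apply Nat.log2_spec. lia.
Qed.

Lemma length_le_root n : n <= 2 ^ (2 ^ levels n - 1).
Proof.
  transitivity (2 ^ Nat.log2 (2 * n + 1)).
  - pose proof (Nat.log2_spec (2 * n + 1) ltac:(lia)) as [_ U].
    rewrite Nat.pow_succ_r' in U. lia.
  - apply Nat.pow_le_mono_r; [lia|]. pose proof (levels_gt n). lia.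
Qed.

Lemma levels_lt n : levels n < 2 ^ levels n.
Proof. apply Nat.pow_gt_lin_r. lia. Qed.

Lemma processors_lt n : 4 * 2 ^ levels n * levels n < 2 ^ (5 * (Nat.log2 n + 1)).
Proof.
  pose proof (levels_le n) as L. pose proof (levels_lt n) as U.
  set (h := 2 ^ levels n) in *. set (l := Nat.log2 n + 1) in *.
  assert (2 * l <= 2 ^ l).
  { unfold l. rewrite Nat.add_1_r, Nat.pow_succ_r'.
    pose proof (Nat.pow_gt_lin_r 2 (Nat.log2 n) ltac:(lia)). lia. }
  (* With y = [2 ^ l] >= 2, both factors [h] and [levels n] are at most y, so the product stays
     below 4 * y^2 <= y^4. *)
  replace (5 * l) with (l + l + l + l + l) by lia. rewrite !Nat.pow_add_r.
  set (y := 2 ^ l) in *. assert (2 <= y) by lia.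
  assert (4 * h * levels n < 4 * y * y) by nia.
  assert (4 <= y * y) by nia.
  assert (y * y * 4 <= y * y * (y * y)) by nia. nia.
Qed.

Lemma levels_pos n : 1 <= levels n.
Proof. unfold levels. lia. Qed.

Lemma subtree_size_lt n : 2 ^ 2 ^ levels n < 2 ^ (5 * (Nat.log2 n + 1)).
Proof. apply Nat.pow_lt_mono_r; [lia|]. pose proof (levels_le n). lia. Qed.

Section Initialization.
Context (n : nat) (o : operation).
Let K := levels n.
Let H := 2 ^ K.
Let ell := Nat.log2 n + 1.
Let P := 4 * H * K.
Let i := position_arg o.
Context (Ho : valid n o).

Notation exec := (execs factor ell P (init_regs n o)).

Lemma init_regs_lt id r : id < P -> init_regs n o id r < 2 ^ (5 * ell).
Proof.
  intros Hid. assert (HP : P < 2 ^ (5 * ell)) by apply processors_lt.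
  assert (Hn : n < 2 ^ (5 * ell)).
  { apply Nat.le_lt_trans with (2 ^ H); [|apply subtree_size_lt].
    transitivity (2 ^ (H - 1)); [apply length_le_root|].
    apply Nat.pow_le_mono_r; lia. }
  assert (H2 : 2 < 2 ^ (5 * ell)).
  { apply Nat.lt_le_trans with (2 ^ 5); [simpl; lia|].
    apply Nat.pow_le_mono_r; unfold ell; lia. }
  unfold init_regs. destruct r as [|[|[|[|r]]]]; cbn [nth].
  - lia.
  - auto.
  - destruct o; cbn [position_arg valid] in *; lia.
  - destruct o as [? []| |]; cbn [symbol_arg]; lia.
  - destruct r; cbn [nth]; lia.
Qed.

Definition same_except_cell (t y : nat) (m m' : memory) : Prop :=
  forall t' x, 0 < t' < 16 -> t' <> t \/ x <> y -> arr m' t' x = arr m t' x.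

Lemma exec_param (p : nat) (c v : expr) (m : memory) (cb : nat -> bool) (val id0 : nat) :
  fits_store factor (put c 1 (Num p) v) = true -> small ell m ->
  (forall id, id < P -> neval (init_regs n o id) m c = Nat.b2n (cb id)) ->
  (forall id, id < P -> cb id = true -> neval (init_regs n o id) m v = val) ->
  val <= P -> id0 < P -> cb id0 = true ->
  exists m', exec [put c 1 (Num p) v] m m' /\ small ell m' /\
    same_except_cell 1 p m m' /\ arr m' 1 p = val.
Proof.
  intros Hf Hm Hc Hv Hval Hid Hcb. assert (HP : P < 2 ^ (5 * ell)) by apply processors_lt.
  destruct (exec_put factor ell P (init_regs n o) (Nat.le_add_l 1 _) init_regs_lt
    c 1 (Num p) v m cb (fun _ => p) (fun _ => val) ltac:(lia) Hf Hm Hc)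
    as (m' & X & S' & W & U); auto.
  { intros id Hid1 Hb. repeat split; auto. lia. }
  exists m'. repeat split; auto.
  - intros t x Ht Hne. unfold arr. apply U; [lia|]. intros. lia.
  - now apply (W id0).
Qed.

Lemma clear_correct (l : list nat) m :
  (forall t, In t l -> 0 < t < 16) ->
  forallb (fits_store factor) (map (fun t => put (Num 1) t (Arg 0) (Num 0)) l) = true ->
  small ell m ->
  exists m', exec (map (fun t => put (Num 1) t (Arg 0) (Num 0)) l) m m' /\
    small ell m' /\
    (forall t x, In t l -> x < P -> arr m' t x = 0) /\
    (forall t x, 0 < t < 16 -> ~ In t l -> arr m' t x = arr m t x).
Proof.
  revert m; induction l as [|t l IH]; intros m Hl Hf Hm.
  - exists m. repeat split; auto. intros t x [].
  - simpl in Hf. apply andb_prop in Hf as [Hf1 Hf2].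
    destruct (exec_put factor ell P (init_regs n o) (Nat.le_add_l 1 _) init_regs_lt
      (Num 1) t (Arg 0) (Num 0) m (fun _ => true) (fun id => id) (fun _ => 0)
      ltac:(apply Hl; now left) Hf1 Hm)
      as (m1 & X1 & S1 & W1 & U1); auto.
    { intros id Hid _. repeat split. apply Nat.neq_0_lt_0, Nat.pow_nonzero. lia. }
    destruct (IH m1) as (m2 & X2 & S2 & W2 & U2); auto.
    { intros t' Ht'. apply Hl. now right. }
    exists m2. repeat split; auto.
    + exact (execs_app _ _ _ _ [_] _ _ _ _ X1 X2).
    + intros t' x Ht Hx. destruct (in_dec Nat.eq_dec t' l) as [|Hni]; auto.
      destruct Ht as [->|]; [|contradiction].
      rewrite U2; auto. apply Hl. now left.
    + intros t' x Ht Hni. simpl in Hni. rewrite U2 by tauto. unfold arr.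
      apply U1; [lia|]. intros id _ _. specialize (Hl t (or_introl eq_refl)).
      intros E. apply Hni. left. lia.
Qed.

(** The three expressions may read the leaf, whose address involves 2^K. They are therefore
    evaluated only after parameter 2 is in place, while the tree is still intact. *)
Lemma init_code_correct (f : nat -> symbol) (act up e0 : bool)
    (active upe start : expr) m :
  0 < n ->
  forallb (fits_store factor) (init_code active upe start) = true ->
  small ell m -> tree K f m ->
  (forall m1 id e b, In (e, b) [(active, act); (upe, up); (start, e0)] ->
     tree K f m1 -> arr m1 1 2 = H -> id < P ->
     neval (init_regs n o id) m1 e = Nat.b2n b) ->
  exists m', exec (init_code active upe start) m m' /\ small ell m' /\
    tree K f m' /\ params K up e0 act m' /\
    forall t x, 3 < t < 10 -> x < P -> arr m' t x = 0.
Proof.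
  intros Hn Hf Hm Ht He. assert (HK : 1 <= K) by apply levels_pos.
  unfold init_code in Hf. rewrite forallb_app in Hf.
  apply andb_prop in Hf as [Hf Hfc]. cbn [forallb] in Hf.
  apply andb_prop in Hf as [F1 Hf]. apply andb_prop in Hf as [F2 Hf].
  apply andb_prop in Hf as [F3 Hf]. apply andb_prop in Hf as [F4 Hf].
  apply andb_prop in Hf as [F5 Hf]. apply andb_prop in Hf as [F6 _].
  assert (HKH : K < H) by apply levels_lt.
  set (l := Nat.log2 (2 * n + 1)).
  assert (Hl : l < H) by apply levels_gt.
  assert (HHP : H < P) by (unfold P; nia).
  assert (Htr : forall p m1 m2, same_except_cell 1 p m1 m2 -> tree K f m1 ->
    tree K f m2).
  { intros p m1 m2 Hs Hm1 j x Hj. rewrite !Hs by lia. auto. }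
  destruct (exec_param 0 _ _ m
    (fun id => (2 * n + 1) / 2 ^ id =? 1) l l F1 Hm)
    as (m1 & X1 & S1 & E1 & V1); try lia.
  { intros id Hid. rewrite neval_eq, neval_shr. reflexivity. }
  { intros id Hid Hb%Nat.eqb_eq. apply div_pow2_eq_1 in Hb as [_ <-]. reflexivity. }
  { apply Nat.eqb_eq, div_pow2_eq_1. split; [lia|reflexivity]. }
  assert (Hl0 : 0 < l) by (apply Nat.log2_pos; lia).
  destruct (exec_param 1 _ _ m1
    (fun id => l / 2 ^ id =? 1) K (Nat.log2 l) F2 S1)
    as (m2 & X2 & S2 & E2 & V2); try lia.
  { intros id Hid. rewrite neval_eq, neval_shr. unfold e_log, param.
    rewrite neval_get, !neval_num, V1. reflexivity. }
  { intros id Hid Hb%Nat.eqb_eq. apply div_pow2_eq_1 in Hb as [_ <-]. reflexivity. }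
  { pose proof (Nat.log2_lt_lin l). lia. }
  { apply Nat.eqb_eq, div_pow2_eq_1. split; [lia|reflexivity]. }
  assert (HlevK : forall m id, arr m 1 1 = K ->
    neval (init_regs n o id) m e_levels = K) by auto.
  destruct (exec_param 2 _ _ m2
    (fun id => (id / 2 ^ K =? 1) && ((id - 1) / 2 ^ K =? 0)) H H F3 S2)
    as (m3 & X3 & S3 & E3 & V3); try lia.
  { intros id Hid. apply neval_and; [|intros _];
      rewrite neval_eq, neval_shr, HlevK by auto; reflexivity. }
  (* The power is found by search: [id] has reached 2^K and [id - 1] has not. *)
  { intros id Hid [Hb1 Hb2]%andb_prop. apply Nat.eqb_eq in Hb1, Hb2.
    change (id = 2 ^ K). pose proof (Nat.pow_nonzero 2 K ltac:(lia)).
    pose proof (block_eq id K) as Eid. rewrite Hb1 in Eid.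
    pose proof (mod_pow2_lt id K).
    apply Nat.div_small_iff in Hb2; auto. lia. }
  { unfold H. pose proof (Nat.pow_nonzero 2 K ltac:(lia)). apply andb_true_intro.
    rewrite Nat.div_same, Nat.div_small by lia. auto. }
  assert (T3 : tree K f m3) by eauto.
  assert (Hb1 : forall b, Nat.b2n b <= P) by (intros []; simpl; lia).
  destruct (exec_param 3 _ _ m3 (fun _ => true) (Nat.b2n act) 0 F4 S3)
    as (m4 & X4 & S4 & E4 & V4); auto; try lia.
  { intros id Hid _. apply He; simpl; auto. }
  assert (T4 : tree K f m4) by eauto.
  assert (V4' : arr m4 1 2 = H) by (rewrite E4 by lia; auto).
  destruct (exec_param 4 _ _ m4 (fun _ => true) (Nat.b2n up) 0 F5 S4)
    as (m5 & X5 & S5 & E5 & V5); auto; try lia.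
  { intros id Hid _. apply He; simpl; auto. }
  assert (T5 : tree K f m5) by eauto.
  assert (V5' : arr m5 1 2 = H) by (rewrite E5 by lia; auto).
  destruct (exec_param 5 _ _ m5 (fun _ => true) (Nat.b2n e0) 0 F6 S5)
    as (m6 & X6 & S6 & E6 & V6); auto; try lia.
  { intros id Hid _. apply He; simpl; auto. }
  assert (T6 : tree K f m6) by eauto.
  destruct (clear_correct (seq 4 6) m6) as (m7 & X7 & S7 & Z7 & U7); auto.
  { intros t Ht'%in_seq. lia. }
  exists m7. split; [|split; [auto|split; [|split]]].
  - unfold init_code. eapply execs_app; [|exact X7].
    eapply (execs_app _ _ _ _ [_]); [exact X1|].
    eapply (execs_app _ _ _ _ [_]); [exact X2|].
    eapply (execs_app _ _ _ _ [_]); [exact X3|].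
    eapply (execs_app _ _ _ _ [_]); [exact X4|].
    eapply (execs_app _ _ _ _ [_]); [exact X5|exact X6].
  - intros j x Hj. rewrite !U7 by (rewrite ?in_seq; lia). auto.
  - unfold params. rewrite !U7 by (rewrite ?in_seq; lia).
    repeat split.
    + rewrite E6, E5, E4, E3 by lia. auto.
    + rewrite E6, E5 by lia. auto.
    + rewrite E6, E5 by lia. auto.
    + rewrite E6 by lia. auto.
    + auto.
  - intros t x Ht' Hx. apply Z7; auto. apply in_seq. lia.
Qed.

Lemma neval_leaf (f : nat -> symbol) m id :
  tree K f m -> arr m 1 2 = H ->
  neval (init_regs n o id) m (e_leaf 2) = fst (node_residue f 0 i) /\
  neval (init_regs n o id) m (e_leaf 3) = snd (node_residue f 0 i).
Proof.
  intros Ht HH.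
  assert (E : neval (init_regs n o id) m (e_node (Arg 2) (Num 0)) =
              i * 2 ^ K + (2 ^ K - 1 - 0)).
  { unfold e_node. rewrite neval_add, neval_mul, !neval_sub, !neval_num.
    unfold e_size, param. rewrite neval_get, neval_num, HH. reflexivity. }
  unfold e_leaf. rewrite !neval_get, E. apply Ht.
  apply Nat.neq_0_lt_0, Nat.pow_nonzero. lia.
Qed.
End Initialization.

(** * The algorithm *)

Lemma node_residue_0 f x :
  node_residue f 0 x = match f x with Some c => unit_residue c | None => (0, 0) end.
Proof.
  unfold node_residue. simpl. rewrite Nat.mul_1_r.
  destruct (f x) as [c|]; auto. apply comb_0_r.
Qed.

Lemma length_replace_at i c s : i < length s -> length (replace_at i c s) = length s.
Proof.
  intros Hi. unfold replace_at. rewrite length_app, length_firstn. cbn [length].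
  rewrite length_skipn. lia.
Qed.

Lemma at_pos_replace_at i c s p :
  i < length s ->
  at_pos (replace_at i c s) p = if p =? i then c else at_pos s p.
Proof.
  unfold at_pos, replace_at. revert s p.
  induction i as [|i IH]; intros [|x s] [|p] Hi; simpl in Hi; try lia; auto.
  cbn [firstn app nth]. change (skipn (S (S i)) (x :: s)) with (skipn (S i) s).
  rewrite IH by lia. reflexivity.
Qed.

Lemma nth_error_at_pos s i : i < length s -> nth_error s i = Some (at_pos s i).
Proof. intros Hi. now apply nth_error_nth'. Qed.

Lemma length_apply_op o s : valid (length s) o -> length (apply_op o s) = length s.
Proof.
  destruct o as [i c|i|]; simpl; intros Hi; auto.
  - rewrite nth_error_at_pos by auto.
    destruct (at_pos s i); auto. now apply length_replace_at.
  - now apply length_replace_at.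
Qed.

(** Only the residues persist between operations; parameters and working arrays are rebuilt by every
    update. *)
Definition state (n : nat) (s : list symbol) (m : memory) : Prop :=
  small (Nat.log2 n + 1) m /\ tree (levels n) (at_pos s) m.

Lemma state_initial n : state n (repeat None n) (fun _ => 0).
Proof.
  split.
  - intros a. apply Nat.neq_0_lt_0, Nat.pow_nonzero. lia.
  - intros j x _. replace (node_residue _ j x) with (0, 0); auto.
    revert x; induction j as [|j IH]; intros x.
    + rewrite node_residue_0. unfold at_pos. now rewrite nth_repeat.
    + now rewrite node_residue_S, <- !IH.
Qed.

Lemma exec_update n o (f f' : nat -> symbol) (act up e0 : bool)
    (active upe start : expr) m :
  valid n o -> position_arg o < n ->
  forallb (fits_store factor) (init_code active upe start) = true ->
  small (Nat.log2 n + 1) m -> tree (levels n) f m ->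
  (forall m1 id e b, In (e, b) [(active, act); (upe, up); (start, e0)] ->
     tree (levels n) f m1 -> arr m1 1 2 = 2 ^ levels n ->
     neval (init_regs n o id) m1 e = Nat.b2n b) ->
  (forall p, p <> position_arg o -> f' p = f p) ->
  (if act then moves up e0 (node_residue f 0 (position_arg o))
                           (node_residue f' 0 (position_arg o))
   else f' (position_arg o) = f (position_arg o)) ->
  exists m', execs factor (Nat.log2 n + 1) (4 * 2 ^ levels n * levels n)
               (init_regs n o) (init_code active upe start ++ update_code) m m' /\
    small (Nat.log2 n + 1) m' /\ tree (levels n) f' m'.
Proof.
  intros Ho Hi Hf Hm Ht He Hf' Hmove.
  destruct (init_code_correct n o Ho f act up e0 active upe start m)
    as (m1 & X1 & S1 & T1 & P1 & Z1); auto; try lia.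
  destruct (update_code_correct n o (Nat.log2 n + 1) (levels n) up e0 act f
    (Nat.le_add_l 1 _) (levels_pos n) (processors_lt n) (subtree_size_lt n) (init_regs_lt n o Ho) f' Hf' Hmove m1)
    as (m2 & X2 & S2 & T2); auto.
  exists m2. split; auto. eapply execs_app; eauto.
Qed.

Lemma exec_set n i c s m :
  i < n -> length s = n -> state n s m ->
  exists m', execs factor (Nat.log2 n + 1) (4 * 2 ^ levels n * levels n)
               (init_regs n (Set_op i c)) set_code m m' /\
    state n (apply_op (Set_op i c) s) m'.
Proof.
  intros Hi Hs [Hm Ht]. rewrite <- Hs in Hi. unfold state. simpl apply_op.
  rewrite nth_error_at_pos by auto.
  apply exec_update with (f := at_pos s)
    (act := match at_pos s i with None => true | Some _ => false end)
    (up := match c with Lpar => true | Rpar => false end)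
    (e0 := match c with Lpar => false | Rpar => true end); auto.
  - simpl. lia.
  - simpl. lia.
  - intros m1 id e b He T1 HH.
    destruct (neval_leaf n (Set_op i c) (at_pos s) m1 id T1 HH) as [E2 E3].
    simpl in He. destruct He as [[= <- <-]|[[= <- <-]|[[= <- <-]|[]]]].
    + unfold e_void. rewrite neval_eq, neval_add, E2, E3, node_residue_0.
      simpl position_arg. now destruct (at_pos s i) as [[]|].
    + rewrite neval_eq. now destruct c.
    + rewrite neval_eq. now destruct c.
  - simpl. intros p Hp. destruct (at_pos s i); auto.
    rewrite at_pos_replace_at by auto.
    destruct (Nat.eqb_spec p i); congruence.
  - simpl. destruct (at_pos s i) eqn:E; auto.
    rewrite !node_residue_0, at_pos_replace_at, Nat.eqb_refl, E by auto.
    destruct c; simpl; auto.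
Qed.

Lemma exec_reset n i s m :
  i < n -> length s = n -> state n s m ->
  exists m', execs factor (Nat.log2 n + 1) (4 * 2 ^ levels n * levels n)
               (init_regs n (Reset_op i)) reset_code m m' /\
    state n (apply_op (Reset_op i) s) m'.
Proof.
  intros Hi Hs [Hm Ht]. rewrite <- Hs in Hi. unfold state. simpl apply_op.
  set (closing := match at_pos s i with Some Rpar => true | _ => false end).
  apply exec_update with (f := at_pos s)
    (act := match at_pos s i with None => false | Some _ => true end)
    (up := closing) (e0 := closing); auto.
  - simpl. lia.
  - simpl. lia.
  - intros m1 id e b He T1 HH.
    destruct (neval_leaf n (Reset_op i) (at_pos s) m1 id T1 HH) as [E2 E3].
    rewrite node_residue_0 in E2, E3. simpl position_arg in E2, E3.
    assert (Hv : neval (init_regs n (Reset_op i) id) m1 e_void =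
      Nat.b2n (match at_pos s i with None => true | Some _ => false end)).
    { unfold e_void. rewrite neval_eq, neval_add, E2, E3.
      now destruct (at_pos s i) as [[]|]. }
    assert (Hc : neval (init_regs n (Reset_op i) id) m1 (e_eq (e_leaf 2) (Num 1)) =
      Nat.b2n closing).
    { unfold closing. rewrite neval_eq, E2.
      now destruct (at_pos s i) as [[]|]. }
    simpl in He. destruct He as [[= <- <-]|[[= <- <-]|[[= <- <-]|[]]]]; auto.
    rewrite (neval_not _ _ _ _ Hv). now destruct (at_pos s i).
  - simpl. intros p Hp. rewrite at_pos_replace_at by auto.
    destruct (Nat.eqb_spec p i); congruence.
  - simpl. unfold closing. destruct (at_pos s i) as [c|] eqn:E.
    + rewrite !node_residue_0, at_pos_replace_at, Nat.eqb_refl, E by auto.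
      destruct c; simpl; auto.
    + rewrite at_pos_replace_at, Nat.eqb_refl by auto. auto.
Qed.

Lemma exec_member n s m :
  length s = n -> state n s m ->
  exists m', execs factor (Nat.log2 n + 1) (4 * 2 ^ levels n * levels n)
               (init_regs n Member_op) member_code m m' /\
    state n s m' /\ answers m' (D1 (erase_void s)).
Proof.
  intros Hs [Hm Ht].
  set (P := 4 * 2 ^ levels n * levels n).
  assert (HP : 0 < P).
  { unfold P. pose proof (levels_gt n). pose proof (levels_pos n). nia. }
  set (v := 1 - (arr m 2 0 + arr m 3 0)).
  set (ws := map (fun _ : nat => (0, v)) (seq 0 P)).
  assert (Hws : requests (factor * (Nat.log2 n + 1)) (init_regs n Member_op)
    (seq 0 P) m (hd (Num 0, Num 0) member_code) = ws).
  { apply map_ext_in. intros id Hid%in_seq. cbn [member_code hd fst snd].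
    f_equal.
    - apply word_small, Nat.neq_0_lt_0, Nat.pow_nonzero. lia.
    - apply (weval_neval factor (Nat.log2 n + 1)); auto.
      + lia.
      + intros r. apply init_regs_lt; simpl; auto. unfold P in Hid. lia. }
  assert (Hin : forall x, In x ws -> x = (0, v)).
  { intros x (id & <- & _)%in_map_iff. reflexivity. }
  assert (Hcw : forall x y, In x ws -> In y ws -> fst x = fst y -> snd x = snd y).
  { intros x y ->%Hin ->%Hin. reflexivity. }
  assert (E0 : commit ws m 0 = v).
  { apply (commit_hit ws m (0, v)); auto. apply in_map_iff. exists 0.
    split; auto. apply in_seq. lia. }
  assert (Ea : forall a, a <> 0 -> commit ws m a = m a).
  { intros a Ha. apply commit_miss. intros x ->%Hin. simpl. auto. }
  exists (commit ws m). split; [|split; [split|]].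
  - unfold execs, member_code. cbn [exec_all]. unfold exec_store.
    cbn [hd member_code] in Hws. rewrite Hws. now rewrite common_writes_spec.
  - intros a. destruct (Nat.eq_dec a 0) as [->|Ha].
    + rewrite E0. apply Nat.le_lt_trans with 1; [unfold v; lia|].
      apply Nat.pow_gt_1; lia.
    + rewrite Ea by auto. apply Hm.
  - intros j x Hj. unfold arr. rewrite !Ea by lia. now apply Ht.
  - pose proof (levels_gt n).
    destruct (Ht (2 ^ levels n - 1) 0) as [Ea0 Eb0]; [lia|].
    rewrite Nat.sub_diag in Ea0, Eb0. simpl (0 * _ + 0) in Ea0, Eb0.
    rewrite node_residue_root in Ea0, Eb0
      by (subst n; apply (length_le_root (length s))).
    unfold answers. rewrite E0, D1_residue. unfold v. rewrite Ea0, Eb0.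
    destruct (residue (erase_void s)) as [a b]; simpl fst; simpl snd.
    destruct (Nat.eq_dec (a + b) 0) as [E|E].
    + left. split; [f_equal; lia|lia].
    + right. split; [intros [= -> ->]; lia|lia].
Qed.

(** Code without jumps runs for exactly its length, which does not depend on n. The sum bounds all
    three programs, and halted processors idle for the rest. *)
Definition time_bound : nat :=
  length (compile_all set_code) + length (compile_all reset_code) +
  length (compile_all member_code).

Lemma execs_executes n o l m m' :
  program_of D1_algorithm o = compile_all l ->
  forallb store_args_only l = true ->
  length (compile_all l) <= time_bound ->
  execs factor (Nat.log2 n + 1) (4 * 2 ^ levels n * levels n) (init_regs n o) l m m' ->
  executes D1_algorithm time_bound n o m m'.
Proof. intros Hp Ho HT Hx. exact (executes_compile _ _ _ _ _ _ _ Hp Ho HT Hx). Qed.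

Lemma handles_state n os s m :
  Forall (valid n) os -> state n s m -> length s = n ->
  handles D1_algorithm time_bound n m s os.
Proof.
  intros Hos. revert s m.
  induction Hos as [|o os Ho _ IH]; intros s m Hst Hs; simpl; auto.
  assert (Hs' : length (apply_op o s) = n).
  { rewrite <- Hs. apply length_apply_op. now rewrite Hs. }
  destruct o as [i c|i|].
  - destruct (exec_set n i c s m) as (m' & X & Hst'); auto.
    exists m'. split; [|split; [discriminate|now apply IH]].
    apply execs_executes with set_code; [reflexivity|reflexivity| |exact X].
    unfold time_bound. rewrite <- Nat.add_assoc. apply Nat.le_add_r.
  - destruct (exec_reset n i s m) as (m' & X & Hst'); auto.
    exists m'. split; [|split; [discriminate|now apply IH]].
    apply execs_executes with reset_code; [reflexivity|reflexivity| |exact X].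
    unfold time_bound. rewrite (Nat.add_comm (length _)), <- Nat.add_assoc.
    apply Nat.le_add_r.
  - destruct (exec_member n s m) as (m' & X & Hst' & Hans); auto.
    exists m'. split; [|split; [auto|now apply IH]].
    apply execs_executes with member_code; [reflexivity|reflexivity| |exact X].
    unfold time_bound. rewrite Nat.add_comm. apply Nat.le_add_r.
Qed.

Lemma D1_algorithm_correct : solves_member_D1_in_time D1_algorithm time_bound.
Proof.
  intros n os Hos. apply handles_state; auto.
  - apply state_initial.
  - apply repeat_length.
Qed.

Lemma processors_bigO :
  bigO (processors D1_algorithm) (fun n => Nat.log2 n * Nat.log2 (Nat.log2 n)).
Proof.
  (* For n >= 4, with a = log2 n and b = log2 a, [2 ^ levels n] <= 4 * a and [levels n] <= 3 * b;
     hence 4 * 4 * 3 = 48. *)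
  exists 48, 4. intros n Hn. cbn [processors D1_algorithm].
  pose proof (levels_le n) as Hsize.
  assert (L : 2 <= Nat.log2 n) by (apply (Nat.log2_le_mono 4); auto).
  assert (LL : 1 <= Nat.log2 (Nat.log2 n)) by (apply (Nat.log2_le_mono 2); auto).
  assert (Hk : levels n <= Nat.log2 (Nat.log2 n) + 2).
  { unfold levels. rewrite Nat.log2_succ_double by lia.
    pose proof (Nat.log2_le_mono (S (Nat.log2 n)) (2 * Nat.log2 n) ltac:(lia)) as G.
    rewrite Nat.log2_double in G by lia. lia. }
  set (a := Nat.log2 n) in *. set (b := Nat.log2 a) in *.
  set (h := 2 ^ levels n) in *. assert (h <= 4 * a) by lia.
  assert (levels n <= 3 * b) by lia. nia.
Qed.

Theorem theorem14 :
  exists A : dynamic_algorithm,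
    solves_member_D1_in_constant_time A /\
    bigO (processors A) (fun n => Nat.log2 n * Nat.log2 (Nat.log2 n)).
Proof.
  exists D1_algorithm. split.
  - exists time_bound. exact D1_algorithm_correct.
  - exact processors_bigO.
Qed.
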